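(* Let $(D,\mathbf r)$ be a regular harmonic structure on a post critically finite (p.c.f.) self-similar structure $(K,\mathcal S,\{F_i:i\in\mathcal S\})$, let $(\mathcal E,\mathcal F)$ be the associated Dirichlet form, let $\partial:\mathcal F\to\mathcal H$ be the associated derivation, let $P$ be the orthogonal projection of $\mathcal H$ onto $\overline{\mathrm{Im}\,\partial}$, and let $F:=P-P^\perp$ with $P^\perp=I-P$. Then $(F,\mathcal H)$ is a Fredholm module over $C(K)$ which is densely $2$-summable; that is, $F=F^*$, $F^2=I$, the commutator $[F,a]$ is a compact operator on $\mathcal H$ for every $a\in C(K)$, and the set of $a\in C(K)$ for which $[F,a]$ is a Hilbert–Schmidt operator is uniformly dense in $C(K)$.
   Context: **Self-similar structures.** $K$ is a compact metrizable space, $\mathcal S=\{1,\dots,N\}$ with $N\ge2$, and each $F_i:K\to K$ ($i\in\mathcal S$) is a continuous injection. Put $\Sigma=\mathcal S^{\mathbb N}$ and $\sigma_i(w_1w_2\dots)=iw_1w_2\dots$. $(K,\mathcal S,\{F_i\})$ is a self-similar structure if there is a continuous surjection $\pi:\Sigma\to K$ with $F_i\circ\pi=\pi\circ\sigma_i$ for all $i$. Let $W_m=\mathcal S^m$ be the set of words of length $m$ and $F_w=F_{w_1}\circ\dots\circ F_{w_m}$ for $w=w_1\dots w_m$ ($F_\emptyset=\mathrm{id}$). With $\sigma(w_1w_2\dots)=w_2w_3\dots$, $K_i=F_i(K)$, $\mathcal C=\pi^{-1}(\bigcup_{i\ne j}K_i\cap K_j)$ and $\mathcal P=\bigcup_{n\ge1}\sigma^n(\mathcal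 C)$, the structure is p.c.f. if $\mathcal P$ is finite. Put $V_0=\pi(\mathcal P)$, $V_m=\bigcup_{w\in W_m}F_w(V_0)$, $V_*=\bigcup_mV_m$ (dense in $K$). For a set $V$, $l(V)$ is the space of scalar functions on $V$. **Harmonic structures.** $D$ is a Laplacian on the finite set $V_0$: a real symmetric nonnegative definite matrix on $V_0$ with nonpositive off-diagonal entries and zero column sums, whose kernel consists of the constants; $\mathcal E_D[u]=(Du|u)$. $\mathbf r=(r_1,\dots,r_N)$ with $r_i>0$, and $r_w=r_{w_1}\cdots r_{w_m}$. Put $\mathcal E^{(m)}[u]=\sum_{w\in W_m}r_w^{-1}\mathcal E_D[u\circ F_w]$ for $u\in l(V_m)$. $(D,\mathbf r)$ is a harmonic structure if $\mathcal E^{(m)}[u]=\min\{\mathcal E^{(m+1)}[v]:v\in l(V_{m+1}),\ v|_{V_m}=u\}$ for all $m\ge0$ and $u\in l(V_m)$; it is regular if $r_i<1$ for all $i\in\mathcal S$. **Dirichlet form.** $\mathcal F=\{u\in l(V_* ):\lim_m\mathcal E^{(m)}[u|_{V_m}]<\infty\}$ and $\mathcal E[u]=\lim_m\mathcal E^{(m)}[u|_{V_m}]$. In the regular case each $u\in\mathcal F$ extends uniquely to a continuous function on $K$, and $\mathcal F$ is thereby a uniformly dense subalgebra of $C(K)$. Complex-valued functions are treated by $\mathcal E[u+iv]=\mathcal E[u]+\mathcal E[v]$ for $u,v$ real. **Derivation.** It is known that there is a Hilbert space $\mathcal H$ carrying a $*$-representation of $C(K)$ (written as multiplication, $a\xi=\xi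 a$), and a linear map $\partial:\mathcal F\to\mathcal H$, with $\partial(ab)=(\partial a)b+a(\partial b)$ for $a,b\in\mathcal F$ and $\|\partial u\|_{\mathcal H}^2=\mathcal E[u]$ for $u\in\mathcal F$. The module also carries an antilinear isometric involution $J$ with $J(a\xi)=\bar a J\xi$ and $J\partial a=\partial\bar a$. The pair is unique up to unitary equivalence when the vectors $(\partial a)b$, $a\in\mathcal F$, $b\in C(K)$, span a dense subspace of $\mathcal H$. For $a\in C(K)$, $[F,a]$ is the commutator of $F$ with the operator by which $a$ acts on $\mathcal H$. *)

(* Defs.v *)
From HB Require Import structures.
From mathcomp Require Import all_boot all_order all_algebra.
From mathcomp Require Import all_classical all_reals all_analysis.
From mathcomp Require Import complex.
Set Implicit Arguments.
Unset Strict Implicit.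
Unset Printing Implicit Defensive.
Import Order.TTheory GRing.Theory Num.Theory.
Import numFieldNormedType.Exports.
Local Open Scope classical_set_scope.
Local Open Scope ring_scope.

(** * Self-similar structures *)

(* The alphabet {1, ..., N} is represented by 'I_N = {0, ..., N - 1}. *)
Definition code_space (N : nat) : Type :=
  prod_topology (fun _ : nat => discrete_topology 'I_N).
HB.instance Definition _ N := Topological.on (code_space N).

Definition code_shift N (w : code_space N) : code_space N := fun k => w k.+1.

Definition code_cons N (i : 'I_N) (w : code_space N) : code_space N :=
  fun k => if k is k'.+1 then w k' else i.

(* The coding map [pi] is uniquely determined by the maps [F i]. *)
Record self_similar_structure (R : realType) (K : metricType R) (N : nat)
    (F : 'I_N -> K -> K) (pi : code_space N -> K) : Prop := {
  sss_compact : compact [set: K] ;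
  sss_alphabet : (2 <= N)%N ;
  sss_continuous : forall i, continuous (F i) ;
  sss_injective : forall i, injective (F i) ;
  sss_pi_continuous : continuous pi ;
  sss_pi_surjective : range pi = [set: K] ;
  sss_pi_commute : forall i w, F i (pi w) = pi (code_cons i w) }.

Section SelfSimilar.
Context {T : Type} {N : nat} (F : 'I_N -> T -> T) (pi : code_space N -> T).

Definition word_map (w : seq 'I_N) : T -> T := foldr (fun i g => F i \o g) id w.

Definition critical_set : set (code_space N) :=
  pi @^-1` [set x | exists i j, [/\ i != j, range (F i) x & range (F j) x]].

Definition post_critical_set : set (code_space N) :=
  [set w | exists2 n, (0 < n)%N & (iter n (@code_shift N) @` critical_set) w].

Definition pcf : Prop := finite_set post_critical_set.

Definition V0 : set T := pi @` post_critical_set.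

Definition Vm (m : nat) : set T :=
  [set x | exists w : m.-tuple 'I_N, (word_map w @` V0) x].

End SelfSimilar.

(** * Harmonic structures *)

(* A matrix on V_0 is a square matrix [D] together with an enumeration
   [v : 'I_n -> K] of V_0. *)
Definition enumerates {T : Type} n (v : 'I_n -> T) (A : set T) : Prop :=
  injective v /\ range v = A.

Definition quad_form {R : realType} n (D : 'M[R]_n) (u : 'cV[R]_n) : R :=
  \sum_i (D *m u) i 0 * u i 0.

Record laplacian (R : realType) n (D : 'M[R]_n) : Prop := {
  lap_sym : D^T = D ;
  lap_ge0 : forall u, 0 <= quad_form D u ;
  lap_offdiag : forall i j, i != j -> D i j <= 0 ;
  lap_colsum : forall j, \sum_i D i j = 0 ;
  lap_ker : forall u : 'cV[R]_n, D *m u = 0 <-> exists c, u = const_mx c }.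

Section Energy.
Context {R : realType} {T : Type} {N : nat}.
Variables (F : 'I_N -> T -> T) (pi : code_space N -> T).
Variables (n : nat) (v : 'I_n -> T) (D : 'M[R]_n) (r : 'I_N -> R).

(* Functions on V_m are represented by functions on the whole space: the energy
   [energy_m m u] only involves the restriction of [u] to V_m. *)
Definition energy_m (m : nat) (u : T -> R) : R :=
  \sum_(w : m.-tuple 'I_N)
    (\prod_(i <- w) r i)^-1 * quad_form D (\col_p u (word_map F w (v p))).

Record harmonic_structure : Prop := {
  hs_laplacian : laplacian D ;
  hs_weight_gt0 : forall i, 0 < r i ;
  hs_min_le : forall m (u u' : T -> R),
    {in Vm F pi m, u' =1 u} -> energy_m m u <= energy_m m.+1 u' ;
  hs_min_attained : forall m (u : T -> R), exists u' : T -> R,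
    {in Vm F pi m, u' =1 u} /\ energy_m m.+1 u' = energy_m m u }.

Record regular_harmonic_structure : Prop := {
  rhs_harmonic : harmonic_structure ;
  rhs_regular : forall i, r i < 1 }.

Definition finite_energy (u : T -> R) : Prop := cvgn (energy_m ^~ u).

Definition energy (a : T -> R[i]) : R :=
  limn (energy_m ^~ (fun x => complex.Re (a x))) +
  limn (energy_m ^~ (fun x => complex.Im (a x))).

End Energy.

Definition continuousC {T : topologicalType} {R : realType} (a : T -> R[i])
  : Prop := continuous (a : T -> (R[i])^o).

(* The domain of the form as a subalgebra of C(K), that is, the set of the
   continuous extensions to K of finite energy functions on V_*. *)
Definition form_domain {R : realType} {K : topologicalType} {N : nat}
    (F : 'I_N -> K -> K) n (v : 'I_n -> K) (D : 'M[R]_n) (r : 'I_N -> R)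
    : set (K -> R[i]) :=
  [set a | [/\ continuousC a,
               finite_energy F v D r (fun x => complex.Re (a x)) &
               finite_energy F v D r (fun x => complex.Im (a x))]].

(** * Operators on a complex Hilbert space *)

(* A Hilbert space is a complete normed module over R[i] whose norm comes from
   an inner product, here linear in the first variable. *)
Record inner_product (R : realType) (H : completeNormedModType R[i])
    (ip : H -> H -> R[i]) : Prop := {
  ip_linear : forall c x y z, ip (c *: x + y) z = c * ip x z + ip y z ;
  ip_conj : forall x y, ip y x = (ip x y)^* ;
  ip_norm : forall x, `|x| ^+ 2 = ip x x }.

Section Operators.
Context {R : realType} {H : completeNormedModType R[i]}.
Variable ip : H -> H -> R[i].
Implicit Types S T P : H -> H.

Definition bounded_operator T : Prop := linear T /\ continuous T.

Definition compact_operator T : Prop :=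
  bounded_operator T /\ precompact (T @` [set x | `|x| <= 1]).

(* Orthonormal bases are taken to be the orthonormal sets whose orthogonal
   complement is trivial; [H] need not be separable. *)
Definition orthonormal_basis (B : set H) : Prop :=
  [/\ forall e, B e -> `|e| = 1,
      forall e f, B e -> B f -> e != f -> ip e f = 0 &
      forall x, (forall e, B e -> ip x e = 0) -> x = 0].

Definition hilbert_schmidt T : Prop :=
  bounded_operator T /\
  exists2 B, orthonormal_basis B &
    (\esum_(e in B) (complex.Re `|T e| ^+ 2)%:E < +oo)%E.

Definition orthogonal_projection P (M : set H) : Prop :=
  forall x, M (P x) /\ forall y, M y -> ip (x - P x) y = 0.

Definition commutator S T : H -> H := fun x => S (T x) - T (S x).

End Operators.

Section Modules.
Context {R : realType} {K : topologicalType} {H : completeNormedModType R[i]}.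
Variable ip : H -> H -> R[i].
(* Only the values of [rho] on continuous functions are relevant. *)
Variable rho : (K -> R[i]) -> H -> H.

Record star_representation : Prop := {
  rep_bounded : forall a, continuousC a -> bounded_operator (rho a) ;
  rep_linear : forall c a b x, continuousC a -> continuousC b ->
    rho (fun t => c * a t + b t) x = c *: rho a x + rho b x ;
  rep_mul : forall a b x, continuousC a -> continuousC b ->
    rho (fun t => a t * b t) x = rho a (rho b x) ;
  rep_star : forall a x y, continuousC a ->
    ip (rho a x) y = ip x (rho (fun t => (a t)^*) y) }.

Record conjugation (J : H -> H) : Prop := {
  conj_antilinear : forall c x y, J (c *: x + y) = c^* *: J x + J y ;
  conj_isometric : forall x, `|J x| = `|x| ;
  conj_involutive : involutive J ;
  conj_rep : forall a x, continuousC a ->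
    J (rho a x) = rho (fun t => (a t)^*) (J x) }.

Record derivation (dom : set (K -> R[i])) (en : (K -> R[i]) -> R)
    (J : H -> H) (d : (K -> R[i]) -> H) : Prop := {
  der_linear : forall c a b, dom a -> dom b ->
    d (fun t => c * a t + b t) = c *: d a + d b ;
  der_leibniz : forall a b, dom a -> dom b ->
    d (fun t => a t * b t) = rho b (d a) + rho a (d b) ;
  der_energy : forall a, dom a -> `|d a| ^+ 2 = (en a)%:C%C ;
  der_conj : forall a, dom a -> J (d a) = d (fun t => (a t)^*) }.

Record fredholm_module (F : H -> H) : Prop := {
  fm_rep : star_representation ;
  fm_bounded : bounded_operator F ;
  fm_selfadjoint : forall x y, ip (F x) y = ip x (F y) ;
  fm_involutive : forall x, F (F x) = x ;
  fm_compact : forall a, continuousC a ->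
    compact_operator (commutator F (rho a)) }.

Definition densely_2_summable (F : H -> H) : Prop :=
  forall (a : K -> R[i]) (eps : R), continuousC a -> 0 < eps ->
  exists b : K -> R[i],
    [/\ continuousC b, hilbert_schmidt ip (commutator F (rho b)) &
        forall x, `|a x - b x| <= eps%:C%C].

End Modules.

(* Main.v *)
(** Since [P] fixes [d (a b)], Leibniz' rule gives
    P^perp (a db) = - P^perp (b da) for [a], [b] in the form domain. If the vectors
    [d b_k] are orthonormal, duality and the estimate |b (x) - b (y)|^2 <= C E[b],
    which follows by chaining through nested cells whose contributions decay
    geometrically because r_i < 1, bound sum_k |b_k|^2 uniformly on [K]; therefore
    sum_k |P^perp (a d b_k)|^2 <= C E[a] and P^perp a P is Hilbert-Schmidt. So is
    [F, a] = 2 (P a P^perp - P^perp a P), as P a P^perp = (P^perp a^* P)^*.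

    The space [K] need not be connected, and then functions of zero energy need not
    be constant: the [b_k] are first corrected, without changing [d b_k], by removing
    in each cell their jumps between connected components.

    The form domain is uniformly dense in C(K) because a continuous function can be
    replaced on each small cell by the harmonic extension of its boundary values, and
    compactness of [F, a] passes to uniform limits. *)
Require Import Defs.
From mathcomp Require Import all_boot all_order all_algebra.
From mathcomp Require Import all_classical all_reals all_analysis.
From mathcomp Require Import complex.
From mathcomp Require Import ring lra.
Import numFieldNormedType.Exports.
Local Open Scope classical_set_scope.
Local Open Scope ring_scope.
Set Implicit Arguments.
Unset Strict Implicit.
Unset Printing Implicit Defensive.
Import Order.TTheory GRing.Theory Num.Theory.

(** The closure of the image of [d] contains vectors that are only limits of vectors [d b], and the
    estimate needs one constant for all finite orthonormal families. Hilbert-Schmidt bounds are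
    therefore stated over finite families ([hs_le]), and each family is approximated by vectors
    [d b_k] with an error [eps] chosen after its length, so that the accumulated errors stay
    bounded.

    The duality argument evaluates combinations sum c_k b_k whose coefficients depend on the point,
    hence needs a sup bound for all combinations at once. The correction of the b_k must then be
    linear, which forces one cutoff level for the whole family. Jumps are removed above this level
    only; the oscillation left on the cells of that level is at most [eps] for each b_k and appears
    as the error term eps sum |c_k|, while the constant in front of the energy does not depend on
    the level.

    Oscillations are bounded by square roots of energies, so the geometric series have a ratio [rho]
    with [r i <= rho ^+ 2] rather than the weights themselves. *)

Lemma connect_dist_le (R : numDomainType) (T : finType) (e : rel T)
    (dist : T -> T -> R) (k : R) :
  0 <= k -> (forall x, dist x x = 0) ->
  (forall x y z, dist x z <= dist x y + dist y z) ->
  (forall x y, e x y -> dist x y <= k) ->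
  forall x y, connect e x y -> dist x y <= k *+ #|T|.
Proof.
(* Loops are cut out of the path, so its length is less than [#|T|]. *)
move=> k0 dxx dtri dk x y /connectP[p + ->] => /shortenP[q eq uq _].
have dq : dist x (last x q) <= k *+ size q.
  elim: q x eq {uq} => [|z q IH] x /=; first by rewrite dxx.
  move=> /andP[exz ezq]; rewrite (le_trans (dtri _ z _))// mulrS.
  by rewrite lerD ?dk ?IH.
rewrite (le_trans dq)// ler_wpMn2l//.
by rewrite ltnW// -[(size q).+1]/(size (x :: q)) -(card_uniqP uq) max_card.
Qed.

(** * Energy estimates for a Laplacian on a finite set *)

Section Laplacian.
Context {R : realType} {n : nat} {D : 'M[R]_n}.
Hypothesis lapD : laplacian D.
Implicit Type u : 'cV[R]_n.

Let DC i j : D i j = D j i.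
Proof. by rewrite -{1}(lap_sym lapD) mxE. Qed.

Let rowsum i : \sum_j D i j = 0.
Proof. by rewrite -[RHS](lap_colsum lapD i); apply: eq_bigr. Qed.

(** When the square is expanded, the terms in [u i] alone or [u j] alone vanish, since rows and
    columns of [D] sum to zero. In this form the energy is a sum of squared differences, with
    nonnegative weights off the diagonal. *)
Lemma quad_formE u :
  quad_form D u = 2^-1 * \sum_i \sum_j - D i j * (u i 0 - u j 0) ^+ 2.
Proof.
have -> : \sum_i \sum_j - D i j * (u i 0 - u j 0) ^+ 2 =
    \sum_i \sum_j (2 * (D i j * u j 0 * u i 0)) -
    (\sum_i \sum_j D i j * u i 0 ^+ 2 + \sum_i \sum_j D i j * u j 0 ^+ 2).
  rewrite -big_split -sumrB/=; apply: eq_bigr => i _.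
  by rewrite -big_split -sumrB/=; apply: eq_bigr => j _; ring.
rewrite [X in _ - (X + _)]big1; last by move=> i _; rewrite -mulr_suml rowsum mul0r.
rewrite [X in _ - (_ + X)]exchange_big [X in _ - (_ + X)]big1 /=; last first.
  by move=> i _; rewrite -mulr_suml (lap_colsum lapD) mul0r.
rewrite addr0 subr0 /quad_form mulr_sumr; apply: eq_bigr => i _.
rewrite mxE mulr_suml mulr_sumr; apply: eq_bigr => j _.
by rewrite mulKf// pnatr_eq0.
Qed.

Let term_ge0 u i j : 0 <= - D i j * (u i 0 - u j 0) ^+ 2.
Proof.
have [->|ij] := eqVneq i j; first by rewrite subrr expr0n mulr0.
by rewrite mulr_ge0 ?sqr_ge0// oppr_ge0 (lap_offdiag lapD).
Qed.

(** The pair occurs twice in the double sum, as (i, j) and as (j, i), which absorbs the factor 1/2;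
    all other terms are nonnegative. *)
Lemma quad_form_edge u i j : - D i j * (u i 0 - u j 0) ^+ 2 <= quad_form D u.
Proof.
have [->|ij] := eqVneq i j.
  by rewrite subrr expr0n mulr0 (lap_ge0 lapD).
rewrite quad_formE (bigD1 i)//= [X in _ * (X + _)](bigD1 j)//=.
rewrite [X in _ * (_ + X)](bigD1 j) 1?eq_sym//= [X in _ * (_ + (X + _))](bigD1 i)//=.
rewrite (DC j i).
have := term_ge0 u i j.
have h1 : 0 <= \sum_(k | k != j) - D i k * (u i 0 - u k 0) ^+ 2.
  by apply: sumr_ge0 => k _; exact: term_ge0.
have h2 : 0 <= \sum_(k | k != i) - D j k * (u j 0 - u k 0) ^+ 2.
  by apply: sumr_ge0 => k _; exact: term_ge0.
have h3 : 0 <= \sum_(k | (k != i) && (k != j))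
    \sum_l - D k l * (u k 0 - u l 0) ^+ 2.
  by apply: sumr_ge0 => k _; apply: sumr_ge0 => l _; exact: term_ge0.
rewrite -(opprB (u j 0)) sqrrN => h4; lra.
Qed.

(** The indicator function of the component of [i] is annihilated by [D], hence constant, and it
    equals 1 at [i]. *)
Lemma laplacian_connected i j : connect (fun i j => D i j < 0) i j.
Proof.
set e := (X in connect X).
have esym : symmetric e by move=> k l; rewrite /e DC.
pose u : 'cV[R]_n := \col_k (connect e i k)%:R.
have Dkl k l : connect e i k != connect e i l -> D k l = 0.
  move=> kl; apply/eqP; rewrite eq_le (lap_offdiag lapD) ?leNgt/=; last first.
    by apply: contraNN kl => /eqP ->.
  apply: contraNN kl => kl.
  by rewrite (same_connect_r (sym_connect_sym esym) (connect1 (kl : e k l))).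
have : D *m u = 0.
  apply/colP => k; rewrite !mxE.
  have [ik|ik] := boolP (connect e i k).
    rewrite -[RHS](rowsum k); apply: eq_bigr => l _; rewrite mxE.
    have [il|il] := boolP (connect e i l); first by rewrite mulr1.
    by rewrite Dkl ?mul0r// ik (negbTE il).
  rewrite big1// => l _; rewrite mxE.
  have [il|il] := boolP (connect e i l); last by rewrite mulr0.
  by rewrite Dkl ?mul0r// il (negbTE ik).
move=> /(lap_ker lapD)[c uc].
have := congr1 (fun w : 'cV_n => w i 0) uc; rewrite !mxE connect0 => c1.
have := congr1 (fun w : 'cV_n => w j 0) uc; rewrite !mxE -c1.
by case: connect => // /eqP; rewrite eq_sym oner_eq0.
Qed.

Lemma quad_form_poincare : exists2 C, 0 <= C &
  forall u i j, `|u i 0 - u j 0| <= C * Num.sqrt (quad_form D u).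
Proof.
(* Pairs that are not joined contribute 0: the square root of a nonpositive number and the inverse
   of 0 are both 0. *)
pose C := \sum_i \sum_j (Num.sqrt (- D i j))^-1.
have Cij i j : (Num.sqrt (- D i j))^-1 <= C.
  rewrite /C (bigD1 i)//= (bigD1 j)//= -addrA lerDl addr_ge0 ?sumr_ge0//.
    by move=> k _; apply: sumr_ge0 => l _; rewrite invr_ge0 sqrtr_ge0.
have C0 : 0 <= C.
  by rewrite sumr_ge0// => i _; apply: sumr_ge0 => j _; rewrite invr_ge0 sqrtr_ge0.
exists (C *+ n) => [|u i j]; first by rewrite mulrn_wge0.
rewrite mulrnAl -[n in _ *+ n]card_ord.
apply: (connect_dist_le (dist := fun k l => `|u k 0 - u l 0|) _ _ _ _
  (laplacian_connected i j)) => [|k|k l m|k l kl].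
- by rewrite mulr_ge0 ?sqrtr_ge0.
- by rewrite subrr normr0.
- exact: ler_distD.
rewrite (le_trans _ (ler_wpM2r (sqrtr_ge0 _) (Cij k l)))//.
have Dkl : 0 < Num.sqrt (- D k l) by rewrite sqrtr_gt0 oppr_gt0.
rewrite mulrC ler_pdivlMr// mulrC -sqrtr_sqr -sqrtrM ?oppr_ge0 ?(ltW kl)//.
by rewrite ler_wsqrtr// quad_form_edge.
Qed.

Lemma quad_form_ub : exists2 C, 0 <= C & forall u (d : R),
  (forall i j, `|u i 0 - u j 0| <= d) -> quad_form D u <= C * d ^+ 2.
Proof.
exists (2^-1 * \sum_i \sum_j `|D i j|) => [|u d ud].
  by rewrite mulr_ge0// sumr_ge0// => i _; apply: sumr_ge0.
rewrite quad_formE -mulrA ler_wpM2l// mulr_suml ler_sum// => i _.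
rewrite mulr_suml ler_sum// => j _.
rewrite (le_trans (ler_wpM2r (sqr_ge0 _) (ler_norm _)))// normrN ler_wpM2l//.
by rewrite -(real_normK (num_real _)) lerXn2r// nnegrE (le_trans _ (ud i j)).
Qed.

End Laplacian.

(** * Cells of the first level and gluing along V_0 *)

Section Cells.
Context {R : realType} {K : metricType R} {N : nat}.
Context {F : 'I_N -> K -> K} {coding : code_space N -> K}.
Hypothesis sss : self_similar_structure F coding.

Lemma code_consK (w : code_space N) : code_cons (w 0%N) (code_shift w) = w.
Proof. by apply/funext => -[|k]. Qed.

Lemma code_shiftK i (w : code_space N) : code_shift (code_cons i w) = w.
Proof. exact/funext. Qed.

Lemma coding_surj x : exists w, coding w = x.
Proof.
by have [w _ <-] : range coding x by [rewrite (sss_pi_surjective sss)]; exists w.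
Qed.

Lemma coding_cell w : F (w 0%N) (coding (code_shift w)) = coding w.
Proof. by rewrite (sss_pi_commute sss) code_consK. Qed.

(** A code of [x] becomes critical when [i] is put in front of it, and one shift takes it back. *)
Lemma cell_inter i j x y : i != j -> F i x = F j y -> V0 F coding x.
Proof.
move=> ij Fij; have [w wx] := coding_surj x.
exists w => //; exists 1%N => //; exists (code_cons i w); last exact: code_shiftK.
exists i, j; split=> //; rewrite -(sss_pi_commute sss) wx; first by exists x.
by rewrite Fij; exists y.
Qed.

(** Either the given code of [F i x] starts with [i], and the shift preserves post-critical codes,
    or [F i x] also lies in another cell and [cell_inter] applies. This makes recursion on cells
    compatible with prescribed values on V_0. *)
Lemma V0_preimage i x : V0 F coding (F i x) -> V0 F coding x.
Proof.
move=> [w [m m0 [c Cc cw]] wx].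
have [wi|wi] := eqVneq (w 0%N) i; last first.
  by apply: (cell_inter (i := i) (j := w 0%N) (y := coding (code_shift w)));
     rewrite 1?eq_sym// coding_cell wx.
exists (code_shift w); first by exists m.+1 => //; exists c => //=; rewrite cw.
by apply: (sss_injective sss (i := i)); rewrite -wx -{1}wi coding_cell.
Qed.

Lemma cell_cover x : exists iy : 'I_N * K, F iy.1 iy.2 = x.
Proof.
have [w <-] := coding_surj x.
by exists (w 0%N, coding (code_shift w)); exact: coding_cell.
Qed.

(** An arbitrary choice. By [cellP], another cell containing [x] meets the chosen one only at images
    of V_0, where the cellwise constructions keep the given values. *)
Definition cell_point x := projT1 (cid (cell_cover x)).
Definition cell_index x := (cell_point x).1.
Definition cell_preimage x := (cell_point x).2.

Lemma cell_preimageK x : F (cell_index x) (cell_preimage x) = x.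
Proof. exact: (projT2 (cid (cell_cover x))). Qed.

Lemma cellP i x j y : F i x = F j y ->
  [/\ i = j & x = y] \/ [/\ V0 F coding x & V0 F coding y].
Proof.
have [<-|ij] := eqVneq i j.
  by move=> Fxy; left; split=> //; exact: (sss_injective sss Fxy).
move=> Fxy; right; split; first exact: cell_inter ij Fxy.
by apply: (cell_inter (i := j) (j := i) (y := x)); rewrite 1?eq_sym.
Qed.

(** Finitely many cells cover [K], and by compactness each [F i] maps closed sets to closed sets. *)
Lemma glue_continuous (T : topologicalType) (g : K -> T) :
  (forall i, continuous (g \o F i)) -> continuous g.
Proof.
move=> gF; apply/continuous_closedP => A clA.
have -> : g @^-1` A = \bigcup_i (F i @` ((g \o F i) @^-1` A)).
  apply/seteqP; split => [x Ax|x [i _ [y Ay <-]]//].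
  exists (cell_index x) => //; exists (cell_preimage x); last exact: cell_preimageK.
  by rewrite /= cell_preimageK.
apply: closed_bigcup; first exact: finite_finset.
move=> i _; apply: compact_closed; first exact: metric_hausdorff.
apply: continuous_compact.
  by apply: continuous_subspaceT => x; exact: (sss_continuous sss).
apply: (subclosed_compact _ (sss_compact sss)) => //.
by move/continuous_closedP : (gF i); apply.
Qed.

Lemma continuous_bounded (g : K -> R) : continuous g ->
  exists2 B, 0 <= B & forall x, `|g x| <= B.
Proof.
move=> cg; have /compact_bounded : compact (range g).
  apply: continuous_compact; last exact: (sss_compact sss).
  exact: continuous_subspaceT.
move=> [M [Mreal HM]]; exists (`|M| + 1) => [|x]; first by rewrite addr_ge0.
by apply: (HM (`|M| + 1)); [rewrite (le_lt_trans (ler_norm M))// ltrDl|exists x].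
Qed.

End Cells.

(** * Self-similarity and monotonicity of the energies *)

Section EnergyTheory.
Context {R : realType} {K : Type} {N : nat}.
Context {F : 'I_N -> K -> K} {coding : code_space N -> K}.
Context {n : nat} {v : 'I_n -> K} {D : 'M[R]_n} {r : 'I_N -> R}.
Local Notation E := (energy_m F v D r).
Implicit Type u f g : K -> R.

Lemma energy_m0 u : E 0 u = quad_form D (\col_p u (v p)).
Proof.
rewrite /energy_m (big_pred1 [tuple]) => [|w]; last exact/esym/eqP/tuple0.
by rewrite big_nil invr1 mul1r.
Qed.

(** Splitting off the first letter, rather than the last, lets inductions on the level run inside
    one cell, with [u \o F i] in place of [u]. *)
Lemma energy_mS m u : E m.+1 u = \sum_i (r i)^-1 * E m (u \o F i).
Proof.
rewrite /energy_m.
rewrite (reindex (fun p : 'I_N * m.-tuple 'I_N => cons_tuple p.1 p.2))/=; last first.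
  exists (fun t : m.+1.-tuple 'I_N => (thead t, behead_tuple t)) => [[i w] _|t _] /=.
    by congr pair; exact/val_inj.
  by rewrite [RHS]tuple_eta; exact/val_inj.
rewrite -(pair_big xpredT xpredT (fun i (w : m.-tuple 'I_N) =>
  (\prod_(j <- i :: w) r j)^-1 *
  quad_form D (\col_p u (word_map F (i :: w) (v p)))))/=.
apply: eq_bigr => i _; rewrite mulr_sumr; apply: eq_bigr => w _.
by rewrite big_cons invfM mulrA.
Qed.

Hypothesis hs : harmonic_structure F coding v D r.
Let lapD := hs_laplacian hs.
Let rV_ge0 i : 0 <= (r i)^-1.
Proof. by rewrite invr_ge0 ltW// (hs_weight_gt0 hs). Qed.

(** Energies are combinations of squared differences with nonnegative weights, so pointwise
    inequalities between squared differences pass to them. Sums, multiples, products and shifts by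
    constants are all treated this way. *)
Lemma energy_m_comb u f g a b m :
  (forall x y, (u x - u y) ^+ 2 <= a * (f x - f y) ^+ 2 + b * (g x - g y) ^+ 2) ->
  E m u <= a * E m f + b * E m g.
Proof.
elim: m u f g => [|m IH] u f g ufg.
  rewrite !energy_m0 !(quad_formE lapD) !(mulrCA _ 2^-1) -mulrDr ler_wpM2l//.
  rewrite !mulr_sumr -big_split ler_sum// => i _.
  rewrite !mulr_sumr -big_split ler_sum// => j _ /=; rewrite !mxE.
  have [->|ij] := eqVneq i j; first by rewrite !subrr !expr0n !mulr0 addr0.
  rewrite !(mulrCA _ (- D i j)) -mulrDr ler_wpM2l// oppr_ge0.
  exact: (lap_offdiag lapD).
rewrite !energy_mS !mulr_sumr -big_split ler_sum// => i _ /=.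
by rewrite !(mulrCA _ (r i)^-1) -mulrDr ler_wpM2l// IH// => x y; exact: ufg.
Qed.

Lemma energy_m_ge0 m u : 0 <= E m u.
Proof.
elim: m u => [|m IH] u; first by rewrite energy_m0 (lap_ge0 lapD).
by rewrite energy_mS sumr_ge0// => i _; rewrite mulr_ge0.
Qed.

Lemma energy_m_scale m u f a :
  (forall x y, (u x - u y) ^+ 2 <= a * (f x - f y) ^+ 2) -> E m u <= a * E m f.
Proof.
move=> uf; have := @energy_m_comb u f f a 0 m; rewrite mul0r addr0; apply => x y.
by rewrite mul0r addr0.
Qed.

Lemma energy_m_shift m u f c : (forall x, u x = f x + c) -> E m u = E m f.
Proof.
move=> ufc; apply/eqP; rewrite eq_le; apply/andP; split.
  rewrite -[leRHS]mul1r; apply: energy_m_scale => x y.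
  by rewrite mul1r !ufc opprD addrACA subrr addr0.
rewrite -[leRHS]mul1r; apply: energy_m_scale => x y.
by rewrite mul1r !ufc opprD addrACA subrr addr0.
Qed.

Lemma energy_mD m f g : E m (fun x => f x + g x) <= 2 * E m f + 2 * E m g.
Proof.
apply: energy_m_comb => x y; rewrite -subr_ge0.
rewrite (_ : _ - _ = ((f x - f y) - (g x - g y)) ^+ 2) ?sqr_ge0//; ring.
Qed.

Lemma energy_mZ m c f : E m (fun x => c * f x) <= c ^+ 2 * E m f.
Proof. by apply: energy_m_scale => x y; rewrite -mulrBr exprMn. Qed.

Lemma energy_mM m f g A B : (forall x, `|f x| <= A) -> (forall x, `|g x| <= B) ->
  E m (fun x => f x * g x) <= 2 * B ^+ 2 * E m f + 2 * A ^+ 2 * E m g.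
Proof.
move=> fA gB; apply: energy_m_comb => x y.
have sqle (z Z : R) : `|z| <= Z -> z ^+ 2 <= Z ^+ 2.
  move=> zZ; rewrite -(real_normK (num_real _)) lerXn2r// nnegrE//.
  exact: le_trans zZ.
(* The increment of the product is g(x)(f(x) - f(y)) + f(y)(g(x) - g(y)), and (s + t)^2 <= 2 s^2 + 2
   t^2. *)
rewrite (@le_trans _ _ (2 * g x ^+ 2 * (f x - f y) ^+ 2 +
    2 * f y ^+ 2 * (g x - g y) ^+ 2))//.
  rewrite -subr_ge0 (_ : _ - _ =
    (g x * (f x - f y) - f y * (g x - g y)) ^+ 2) ?sqr_ge0//; ring.
by apply: lerD; rewrite ler_wpM2r ?sqr_ge0// ler_wpM2l// sqle.
Qed.

Lemma energy_m_leS m u : E m u <= E m.+1 u.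
Proof. by apply: (hs_min_le hs) => x _. Qed.

Lemma energy_m_homo u : {homo (E ^~ u) : m k / (m <= k)%N >-> m <= k}.
Proof. by apply/nondecreasing_seqP => m; exact: energy_m_leS. Qed.

Lemma energy_m_cell m i u : E m (u \o F i) <= r i * E m.+1 u.
Proof.
rewrite -ler_pdivrMl ?(hs_weight_gt0 hs)// energy_mS (bigD1 i)//= lerDl.
by rewrite sumr_ge0// => j _; rewrite mulr_ge0// energy_m_ge0.
Qed.

Lemma energy_m_le u M : (exists m0, forall m, (m0 <= m)%N -> E m u <= M) ->
  forall m, E m u <= M.
Proof.
move=> [m0 H] m; apply: (le_trans (energy_m_homo u (leq_maxr m0 m))).
by rewrite H// leq_maxl.
Qed.

Lemma finite_energyP u :
  finite_energy F v D r u <-> exists M, forall m, E m u <= M.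
Proof.
split=> [cE|[M EM]].
  by exists (limn (E ^~ u)) => m; exact: nondecreasing_cvgn_le (@energy_m_homo u) cE m.
apply: nondecreasing_is_cvgn; first exact: energy_m_homo.
by exists M => _ [m _ <-].
Qed.

Lemma finite_energy_ub u : finite_energy F v D r u ->
  forall m, E m u <= limn (E ^~ u).
Proof. by move=> cE m; exact: nondecreasing_cvgn_le (@energy_m_homo u) cE m. Qed.

End EnergyTheory.

(** * Oscillation on small cells and cellwise constructions *)

(** Oscillation is measured on whole cells of level [m], not only on V_m; the recursion on the first
    letter matches [energy_mS] and [cell_iter]. *)
Fixpoint cell_osc_le (R : realType) (K : Type) (N : nat) (F : 'I_N -> K -> K)
    (m : nat) (u : K -> R) (d : R) : Prop :=
  if m is m'.+1 then forall i, cell_osc_le F m' (u \o F i) d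
  else forall x y, `|u x - u y| <= d.

Section Oscillation.
Context {R : realType} {K : metricType R} {N : nat}.
Context {F : 'I_N -> K -> K} {coding : code_space N -> K}.
Hypothesis sss : self_similar_structure F coding.
Implicit Types (u f g : K -> R) (d e : R).

Lemma cell_osc_le_comb m u f g c e d :
  (forall x y, `|u x - u y| <= c * `|f x - f y| + `|g x - g y|) ->
  0 <= c -> cell_osc_le F m f d -> cell_osc_le F m g e ->
  cell_osc_le F m u (c * d + e).
Proof.
move=> + c0; elim: m u f g => [|m IH] u f g ufg /= fd ge.
  by move=> x y; rewrite (le_trans (ufg x y))// lerD// ler_wpM2l.
by move=> i; apply: IH (fd i) (ge i) => x y; exact: ufg.
Qed.

Lemma cell_osc_le_mono m k u d : (m <= k)%N ->
  cell_osc_le F m u d -> cell_osc_le F k u d.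
Proof.
elim: k m u => [|k IH] [|m] u //= => [_ ud i|mk ud i]; last exact: IH (ud i).
by apply: (IH 0%N) => // x y; exact: ud.
Qed.

Lemma cell_osc_le_shift m u f c d : (forall x, u x = f x + c) ->
  cell_osc_le F m f d -> cell_osc_le F m u d.
Proof.
elim: m u f => [|m IH] u f ufc /= fd => [x y|i].
  by rewrite !ufc opprD addrACA subrr addr0.
by apply: IH (fd i) => x; rewrite /= ufc.
Qed.

Lemma cvg_code (W : nat -> code_space N) (w : code_space N) :
  (forall k, \forall m \near \oo, W m k = w k) -> W @ \oo --> w.
Proof.
move=> Ww; apply/cvg_sup => k A; rewrite nbhsE => -[B [[C _ <-] wC] sCA].
have := Ww k; apply: filterS => m Wm; apply: sCA.
by rewrite /= Wm.
Qed.

(* König's lemma: otherwise some sequence of nested cells has oscillation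
   greater than [d] at every level, against continuity at its limit point. *)
Lemma continuous_cell_osc u d : continuous u -> 0 < d ->
  exists m, cell_osc_le F m u d.
Proof.
move=> cu d0; apply: contrapT => ubad.
pose bad f := forall m, ~ cell_osc_le F m f d.
have /choice[next nextP] : forall f, exists i, bad f -> bad (f \o F i).
  move=> f; have [fbad|] := pselect (bad f); last first.
    by move=> nbad; exists (Ordinal (ltnW (sss_alphabet sss))).
  apply: contrapT => /forallNP ngood.
  have /choice[m mP] : forall i, exists m, cell_osc_le F m (f \o F i) d.
    move=> i; apply: contrapT => /forallNP nosc.
    by apply: (ngood i) => _ m; exact: nosc.
  apply: (fbad (\max_i m i).+1) => i; apply: cell_osc_le_mono (mP i).
  exact: leq_bigmax.
pose U k := iter k (fun f => f \o F (next f)) u.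
have Ubad k : bad (U k).
  elim: k => [|k IH]; first by move=> m um; apply: ubad; exists m.
  exact: nextP.
pose w : code_space N := fun k => next (U k).
pose prefix k (e : code_space N) : code_space N :=
  fun j => if (j < k)%N then w j else e (j - k)%N.
have UE k (e : code_space N) : U k (coding e) = u (coding (prefix k e)).
  elim: k e => [|k IH] e.
    by congr (u (coding _)); apply/funext => j; rewrite /prefix subn0.
  rewrite /= (sss_pi_commute sss) IH; congr (u (coding _)); apply/funext => j.
  rewrite /prefix [(j < k.+1)%N]ltnS; have [jk|kj|->] := ltngtP j k.
  - by [].
  - by rewrite subnS; case: (j - k)%N (subn_gt0 k j); rewrite kj.
  - by rewrite subnn.
have [k Uk] : exists k, forall e : code_space N, `|u (coding w) - U k (coding e)| < d / 2.
  apply: contrapT => /forallNP nk.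
  have /choice[e eP] : forall k, exists e : code_space N,
      ~ `|u (coding w) - U k (coding e)| < d / 2.
    by move=> k; apply/existsNP; exact: nk.
  have Ww : (fun k => prefix k (e k)) @ \oo --> w.
    by apply: cvg_code => j; exists j.+1 => // k; rewrite /prefix/= => ->.
  have : (u \o coding) (prefix k (e k)) @[k --> \oo] --> u (coding w).
    apply: cvg_comp Ww _; apply: continuous_comp; last exact: cu.
    exact: (sss_pi_continuous sss).
  move=> /cvgrPdist_lt/(_ (d / 2)); rewrite divr_gt0// => /(_ isT)[k _ /(_ k)].
  by rewrite /= leqnn => /(_ isT); rewrite -UE; exact: eP.
apply: (Ubad k 0%N) => x y.
have [e <-] := coding_surj sss x; have [e' <-] := coding_surj sss y.
have h1 := Uk e; have h2 := Uk e'.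
rewrite (le_trans (ler_distD (u (coding w)) _ _))// (splitr d) lerD ?ltW//.
by rewrite distrC.
Qed.

End Oscillation.

Section CellIteration.
Context {R : realType} {K : metricType R} {N : nat}.
Context {F : 'I_N -> K -> K} {coding : code_space N -> K}.
Hypothesis sss : self_similar_structure F coding.
Variables B S : (K -> R) -> K -> R.

(* Applies [S] on the cells of levels 0, ..., m - 1, then [B] on those of level m. *)
Fixpoint cell_iter (m : nat) (u : K -> R) : K -> R :=
  if m is m'.+1 then fun x =>
    cell_iter m' (S u \o F (cell_index sss x)) (cell_preimage sss x)
  else B u.

Hypothesis BV0 : forall u x, V0 F coding x -> B u x = u x.
Hypothesis SV0 : forall u x, V0 F coding x -> S u x = u x.

Lemma cell_iter_V0 m u x : V0 F coding x -> cell_iter m u x = u x.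
Proof.
elim: m u x => [|m IH] u x xV0 /=; first exact: BV0.
rewrite IH/= ?cell_preimageK ?SV0//.
by apply: (V0_preimage sss (i := cell_index sss x)); rewrite cell_preimageK.
Qed.

(** The recursive equation, built into the definition for the chosen cell only, holds on every cell:
    where two cells overlap, both preimages lie in V_0, where the iteration changes nothing. *)
Lemma cell_iterS m u i : cell_iter m.+1 u \o F i = cell_iter m (S u \o F i).
Proof.
apply/funext => x /=.
have [[-> ->]//|[xV0 yV0]] := cellP sss (cell_preimageK sss (F i x)).
by rewrite !cell_iter_V0//= cell_preimageK.
Qed.

Lemma cell_iter_continuous (Q : (K -> R) -> Prop) m u :
  (forall f, Q f -> continuous (B f)) ->
  (forall f i, Q f -> Q (S f \o F i)) -> Q u -> continuous (cell_iter m u).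
Proof.
move=> QB QS; elim: m u => [|m IH] u Qu; first exact: QB.
by apply: (glue_continuous sss) => i; rewrite cell_iterS; apply/IH/QS.
Qed.

End CellIteration.

Lemma exprn_small (R : realType) (rho c z : R) : 0 <= rho < 1 ->
  (forall m, `|z| <= c * rho ^+ m) -> z = 0.
Proof.
move=> /andP[rho0 rho1] zc; apply/normr0_eq0/eqP; rewrite eq_le normr_ge0 andbT.
have cv : c * rho ^+ m @[m --> \oo] --> c * 0.
  by apply: cvgMl_tmp; apply: cvg_expr; rewrite ger0_norm.
rewrite mulr0 in cv; rewrite -(cvg_lim _ cv)//.
by apply: limr_ge; [apply/cvg_ex; exists 0|exact: nearW].
Qed.

(** With k = c / (1 - rho), the intervals of centre [f m] and radius k rho^m are nested, because c =
    k - k rho; the limit is the supremum of their lower ends. *)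
Lemma geometric_limit (R : realType) (rho c : R) (f : nat -> R) :
  0 <= rho < 1 -> (forall m, `|f m.+1 - f m| <= c * rho ^+ m) ->
  exists l, forall m, `|l - f m| <= c / (1 - rho) * rho ^+ m.
Proof.
move=> /andP[rho0 rho1] fc.
have c0 : 0 <= c by have := fc 0%N; rewrite expr0 mulr1; exact: le_trans.
have rho1' : 0 < 1 - rho by rewrite subr_gt0.
pose k := c / (1 - rho).
have kE : c = k * (1 - rho) by rewrite divfK// gt_eqF.
have lower m : f m - k * rho ^+ m <= f m.+1 - k * rho ^+ m.+1.
  have := fc m; rewrite ler_norml kE exprS => /andP[+ _].
  by move=> h; lra.
have upper m : f m.+1 + k * rho ^+ m.+1 <= f m + k * rho ^+ m.
  have := fc m; rewrite ler_norml kE exprS => /andP[_].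
  by move=> h; lra.
have lowerM : {homo (fun m => f m - k * rho ^+ m) : m p / (m <= p)%N >-> m <= p}.
  exact/nondecreasing_seqP.
have upperM : {homo (fun m => f m + k * rho ^+ m) : m p / (m <= p)%N >-> p <= m}.
  exact/nonincreasing_seqP.
have lu m p : f m - k * rho ^+ m <= f p + k * rho ^+ p.
  rewrite (le_trans (lowerM _ _ (leq_maxl m p)))//.
  rewrite (le_trans _ (upperM _ _ (leq_maxr m p)))// lerD2l.
  by rewrite ge0_cp// mulr_ge0// ?exprn_ge0// divr_ge0// ltW.
exists (sup (range (fun m => f m - k * rho ^+ m))) => m.
rewrite ler_distl; apply/andP; split.
  apply: ub_le_sup; last by exists m.
  by exists (f 0%N + k * rho ^+ 0) => _ [p _ <-].
apply: ge_sup; first by exists (f 0%N - k * rho ^+ 0); exists 0%N.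
by move=> _ [p _ <-].
Qed.

(** * Regular harmonic structures *)

Section RegularStructure.
Context {R : realType} {K : metricType R} {N : nat}.
Context {F : 'I_N -> K -> K} {coding : code_space N -> K}.
Context {n : nat} {v : 'I_n -> K} {D : 'M[R]_n} {r : 'I_N -> R}.
Hypothesis sss : self_similar_structure F coding.
Hypothesis venum : enumerates v (V0 F coding).
Hypothesis rhs : regular_harmonic_structure F coding v D r.
Local Notation E := (energy_m F v D r).
Local Notation V0 := (V0 F coding).
Implicit Types (u f g : K -> R).
Let hs := rhs_harmonic rhs.

Let rV_ge0 i : 0 <= (r i)^-1.
Proof. by rewrite invr_ge0 ltW// (hs_weight_gt0 hs). Qed.

Lemma V0_v p : V0 (v p).
Proof. by case: venum => _ <-; exists p. Qed.

(** The bound is by a square because energies contract by [r i] on passing to a cell, while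
    oscillations contract by its square root. *)
Lemma weight_sqr_lt1 : exists2 rho : R, 0 <= rho < 1 & forall i, r i <= rho ^+ 2.
Proof.
exists (\big[Num.max/0]_i Num.sqrt (r i)).
  apply/andP; split; first exact: bigmax_ge_id.
  apply: bigmax_lt => // i _.
  by rewrite -[ltRHS]sqrtr1 ltr_sqrt// (rhs_regular rhs).
move=> i; rewrite -[leLHS](sqr_sqrtr (ltW (hs_weight_gt0 hs i))).
by rewrite lerXn2r ?nnegrE ?sqrtr_ge0 ?bigmax_ge_id//; exact: le_bigmax.
Qed.

Lemma energy_m_const m u c : (forall x, u x = c) -> E m u = 0.
Proof.
move=> uc; apply/eqP; rewrite eq_le (energy_m_ge0 hs) andbT -[leRHS](mul0r (E m u)).
by apply: (energy_m_scale hs) => x y; rewrite !uc subrr expr0n mul0r.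
Qed.

Lemma energy_m0_V0 u f : (forall x, V0 x -> u x = f x) -> E 0 u = E 0 f.
Proof.
move=> uf; rewrite !energy_m0; congr quad_form; apply/colP => p.
by rewrite !mxE uf//; exact: V0_v.
Qed.

Lemma energy_m0_cell i u : E 0 (u \o F i) <= E 1 u.
Proof.
rewrite (le_trans (energy_m_cell hs 0 i u))//.
by rewrite ler_piMl ?(energy_m_ge0 hs)// ltW// (rhs_regular rhs).
Qed.

Lemma poincare_V0 : exists2 C, 0 <= C & forall u x y, V0 x -> V0 y ->
  `|u x - u y| <= C * Num.sqrt (E 0 u).
Proof.
have [C C0 HC] := quad_form_poincare (hs_laplacian hs).
exists C => // u x y; case: venum => _ <- [p _ <-] [q _ <-].
by have := HC (\col_p u (v p)) p q; rewrite energy_m0 !mxE.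
Qed.

Definition adjacent i j := `[< exists x y, F i x = F j y >].

Lemma adjacent_sym : symmetric adjacent.
Proof. by move=> i j; apply/asboolP/asboolP => -[x [y xy]]; exists y, x. Qed.

Let csym := sym_connect_sym adjacent_sym.

Lemma adjacent_cell_index i x : connect adjacent (cell_index sss (F i x)) i.
Proof.
apply/connect1/asboolP; exists (cell_preimage sss (F i x)), x.
exact: cell_preimageK.
Qed.

Variable o : 'I_n.
Let p0 := v o.
Let i0 := cell_index sss p0.
Let q0 := cell_preimage sss p0.

Let p0V : V0 p0. Proof. exact: V0_v. Qed.
Let q0K : F i0 q0 = p0. Proof. exact: cell_preimageK. Qed.
Let q0V : V0 q0.
Proof. by apply: (V0_preimage sss (i := i0)); rewrite q0K. Qed.

Lemma connected_cells_osc : exists2 C, 0 <= C &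
  forall u i j x y, connect adjacent i j -> V0 x -> V0 y ->
  `|u (F i x) - u (F j y)| <= C * Num.sqrt (E 1 u).
Proof.
have [C C0 HC] := poincare_V0.
(* One crossing of cell [i] to [F i p0], at most [N] passages between adjacent cells, each crossing
   two cells through a common point, and one crossing of cell [j]. By the Poincaré inequality inside
   the cell, a crossing costs at most C times the root of the level-1 energy. *)
exists (C + ((C + C) *+ N + C)) => [|u i j x y ij xV yV].
  by rewrite !addr_ge0// mulrn_wge0// addr_ge0.
set k := C * Num.sqrt (E 1 u).
have k0 : 0 <= k by rewrite mulr_ge0// sqrtr_ge0.
have cell l a b : V0 a -> V0 b -> `|u (F l a) - u (F l b)| <= k.
  move=> aV bV; rewrite (le_trans (HC (u \o F l) a b aV bV))// ler_wpM2l//.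
  exact/ler_wsqrtr/energy_m0_cell.
have -> : (C + ((C + C) *+ N + C)) * Num.sqrt (E 1 u) = k + ((k + k) *+ N + k).
  by rewrite !mulrDl mulrnAl mulrDl.
rewrite (le_trans (ler_distD (u (F i p0)) _ _))// lerD ?cell//.
rewrite (le_trans (ler_distD (u (F j p0)) _ _))// lerD ?cell//.
rewrite -[N in _ *+ N]card_ord.
apply: (connect_dist_le (dist := fun a b => `|u (F a p0) - u (F b p0)|)
  _ _ _ _ ij) => [|a|a b c|a b /asboolP[z [t zt]]].
- by rewrite addr_ge0.
- by rewrite subrr normr0.
- exact: ler_distD.
have [[-> _]|[zV tV]] := cellP sss zt; first by rewrite subrr normr0 addr_ge0.
by rewrite (le_trans (ler_distD (u (F a z)) _ _))// lerD ?cell// zt cell.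
Qed.

Definition main_cell i := connect adjacent i0 i.

Lemma main_cell_index i x : main_cell (cell_index sss (F i x)) = main_cell i.
Proof. exact/(same_connect_r csym)/adjacent_cell_index. Qed.

(* Otherwise the indicator function of the main component would have zero energy
   at level 1 and positive energy at level 0. *)
Lemma V0_main x : V0 x -> main_cell (cell_index sss x).
Proof.
move=> xV; pose u y : R := (main_cell (cell_index sss y))%:R.
have E1 : E 1 u = 0.
  rewrite energy_mS big1// => i _.
  rewrite (energy_m_const _ (c := (main_cell i)%:R)) ?mulr0// => y.
  by rewrite /u/= main_cell_index.
have E0 : E 0 u = 0.
  by apply/eqP; rewrite eq_le (energy_m_ge0 hs) andbT -E1 (energy_m_leS hs).
have [C _ HC] := poincare_V0.
have := HC u x p0 xV p0V; rewrite E0 sqrtr0 mulr0 normr_le0 subr_eq0.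
rewrite /u {2}/main_cell connect0 => /eqP.
by case: main_cell => // /esym/eqP; rewrite oner_eq0.
Qed.

(* The main component contains V_0, hence removing these jumps in all cells changes
   neither the values on V_0 nor the energy. *)
Definition cell_jump u i : R :=
  if main_cell i then 0 else u (F (fingraph.root adjacent i) p0) - u p0.

Definition jump_removal u x := u x - cell_jump u (cell_index sss x).

Definition corrected := cell_iter sss id jump_removal.

Lemma cell_jump_index u i x : cell_jump u (cell_index sss (F i x)) = cell_jump u i.
Proof.
rewrite /cell_jump main_cell_index.
by rewrite (fingraph.rootP csym (adjacent_cell_index i x)).
Qed.

Lemma jump_removal_cell u i x : jump_removal u (F i x) = u (F i x) - cell_jump u i.
Proof. by rewrite /jump_removal cell_jump_index. Qed.

Lemma jump_removal_V0 u x : V0 x -> jump_removal u x = u x.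
Proof. by move=> xV; rewrite /jump_removal /cell_jump V0_main// subr0. Qed.

Let corrS m u i : corrected m.+1 u \o F i = corrected m (jump_removal u \o F i).
Proof. by apply: cell_iterS => // f x; exact: jump_removal_V0. Qed.

Lemma corrected_continuous m u : continuous u -> continuous (corrected m u).
Proof.
apply: (@cell_iter_continuous _ _ _ _ _ sss _ _ _ _ (fun f => continuous f)) => // [f x|f i cf x].
  exact: jump_removal_V0.
have -> : jump_removal f \o F i = fun x => f (F i x) - cell_jump f i.
  by apply/funext => y /=; rewrite jump_removal_cell.
apply: cvgB; last exact: cvg_cst.
by apply: continuous_comp; [exact: (sss_continuous sss)|exact: cf].
Qed.

(** Linearity at a fixed level is what allows a whole finite family to be corrected
    simultaneously. *)
Lemma corrected_linear m c u f x :
  corrected m (fun y => c * u y + f y) x = c * corrected m u x + corrected m f x.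
Proof.
elim: m u f x => [//|m IH] u f x; rewrite -(cell_preimageK sss x).
set i := cell_index sss x; set y := cell_preimage sss x.
have e g : corrected m.+1 g (F i y) = corrected m (jump_removal g \o F i) y.
  by rewrite -corrS.
rewrite !e -IH; congr (corrected m _ y); apply/funext => z /=.
rewrite !jump_removal_cell /cell_jump; case: ifP => _; ring.
Qed.

(** On each cell only a constant is subtracted before the correction continues inside, so positive
    levels follow by induction; level 0 is dominated by level 1. *)
Lemma energy_m_corrected k m u : E k (fun x => corrected m u x - u x) = 0.
Proof.
have E0 : (forall k, E k.+1 (fun x => corrected m u x - u x) = 0) ->
    E k (fun x => corrected m u x - u x) = 0.
  move=> ES; case: k => // ; apply/eqP; rewrite eq_le (energy_m_ge0 hs) andbT.
  by rewrite -(ES 0%N) (energy_m_leS hs).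
apply: E0 => {}k; elim: m k u => [|m IH] k u.
  by apply: (energy_m_const _ (c := 0)) => x; rewrite subrr.
have IH' j f : E j (fun x => corrected m f x - f x) = 0.
  case: j => [|j]; last exact: IH.
  apply/eqP; rewrite eq_le (energy_m_ge0 hs) andbT.
  by rewrite -(IH 0%N f) (energy_m_leS hs).
rewrite energy_mS big1// => i _.
rewrite (energy_m_shift hs _ (f := fun x => corrected m (jump_removal u \o F i) x
  - (jump_removal u \o F i) x) (c := - cell_jump u i)) ?IH' ?mulr0// => x.
rewrite -corrS /= jump_removal_cell; ring.
Qed.

(** Chaining from [p0] into nested cells: each step costs C times the current root of energy, which
    shrinks by [rho]. The term [d] enters once, at the last level, where nothing has been corrected;
    hence [G] does not depend on [m]. *)
Lemma corrected_bound : exists2 G, 0 <= G & forall m u M d, 0 <= M ->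
  (forall k, E k u <= M ^+ 2) -> cell_osc_le F m u d ->
  forall x, `|corrected m u x - u p0| <= G * M + d.
Proof.
have [rho /andP[rho0 rho1] rrho] := weight_sqr_lt1.
have [C C0 HC] := connected_cells_osc.
have rho1' : 0 < 1 - rho by rewrite subr_gt0.
exists (C / (1 - rho)) => [|m]; first by rewrite divr_ge0// ltW.
elim: m => [|m IH] u M d M0 uM ud x.
  rewrite (le_trans (ud x p0))// lerDr mulr_ge0// divr_ge0//; exact: ltW.
rewrite -(cell_preimageK sss x).
set i := cell_index sss x; set y := cell_preimage sss x.
rewrite -[corrected _ _ _]/((corrected m.+1 u \o F i) y) corrS.
have fE z : (jump_removal u \o F i) z = (u \o F i) z + (- cell_jump u i).
  exact: jump_removal_cell.
have IHi := IH _ (rho * M) d _ _ (cell_osc_le_shift fE (ud i)) y.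
have {}IHi := IHi (mulr_ge0 rho0 M0) _.
(* The constant G = C / (1 - rho) solves G rho + C = G. *)
have -> : C / (1 - rho) * M + d = (C / (1 - rho) * (rho * M) + d) + C * M.
  by field; rewrite gt_eqF.
rewrite (le_trans (ler_distD ((jump_removal u \o F i) p0) _ _))// lerD//.
  apply: IHi => k; rewrite (energy_m_shift hs _ fE).
  rewrite (le_trans (energy_m_cell hs k i u))// exprMn ler_pM//.
  - by rewrite ltW// (hs_weight_gt0 hs).
  - exact: (energy_m_ge0 hs).
have sM : C * Num.sqrt (E 1 u) <= C * M.
  rewrite ler_wpM2l// -[leRHS](ger0_norm M0) -sqrtr_sqr.
  exact/ler_wsqrtr/uM.
(* In the main component, [p0 = F i0 q0] is reached from [F i p0] through adjacent cells. Elsewhere,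
   removing the jump turns the comparison with [p0] into one with the root cell of the same
   component. *)
rewrite /= jump_removal_cell /cell_jump; case: ifP => [mi|_].
  rewrite subr0 -{2}q0K (le_trans (HC u i i0 p0 q0 _ p0V q0V))//.
  by rewrite csym.
rewrite opprB addrA addrAC addrK.
by rewrite (le_trans _ sM)// HC// connect_root.
Qed.


(** * Harmonic extension and density of the finite energy functions *)

Lemma one_step_minimizer u : exists f : K -> R,
  (forall x, V0 x -> f x = u x) /\ E 1 f = E 0 u.
Proof.
have [f [fu Ef]] := hs_min_attained hs 0 u; exists f; split=> // x xV.
by apply: fu; rewrite inE; exists [tuple], x.
Qed.

(* Outside of the main component, the minimizer is replaced by a constant. *)
Definition harmonic_step u x : R :=
  if main_cell (cell_index sss x) then projT1 (cid (one_step_minimizer u)) x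
  else u p0.

Lemma harmonic_step_V0 u x : V0 x -> harmonic_step u x = u x.
Proof.
move=> xV; rewrite /harmonic_step V0_main//.
by case: cid => f /= [fu _]; exact: fu.
Qed.

Lemma harmonic_step_energy u : E 1 (harmonic_step u) <= E 0 u.
Proof.
case: (projT2 (cid (one_step_minimizer u))) => _ <-.
rewrite !energy_mS ler_sum// => i _; rewrite ler_wpM2l//.
have [mi|mi] := boolP (main_cell i).
  rewrite (energy_m_shift hs _ (f := projT1 (cid (one_step_minimizer u)) \o F i)
    (c := 0))// => x.
  by rewrite /harmonic_step/= main_cell_index mi addr0.
rewrite (energy_m_const _ (c := u p0)) ?(energy_m_ge0 hs)// => x.
by rewrite /harmonic_step/= main_cell_index (negbTE mi).
Qed.

Lemma harmonic_step_osc : exists2 C, 0 <= C & forall u i,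
  `|harmonic_step u (F i p0) - u p0| <= C * Num.sqrt (E 0 u).
Proof.
have [C C0 HC] := connected_cells_osc; exists C => // u i.
rewrite /harmonic_step main_cell_index; case: ifP => [mi|_]; last first.
  by rewrite subrr normr0 mulr_ge0// sqrtr_ge0.
case: cid => f /= [fu <-]; rewrite -(fu p0)// -{2}q0K.
by apply: HC => //; rewrite csym.
Qed.

(** Lagrange interpolation, with distances to the nodes in place of linear factors. *)
Lemma bump_functions : exists chi : 'I_n -> K -> R,
  (forall p, continuous (chi p)) /\ (forall p q, chi p (v q) = (p == q)%:R).
Proof.
exists (fun p x => \prod_(q | q != p) (mdist x (v q) / mdist (v p) (v q))).
have cdist (a : K) : continuous (fun x : K => mdist x a : R).
  move=> x; apply/cvgrPdist_lt => e e0; near=> y.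
  rewrite ltr_distl; apply/andP; split.
    rewrite ltrBlDr (le_lt_trans (metric_triangle _ x _))// addrC ltrD2l.
    near: y; have := nbhsx_ballx x e e0; apply: filterS => y.
    by rewrite ballEmdist/= metric_sym.
  rewrite (le_lt_trans (metric_triangle _ y _))// addrC ltrD2l.
  near: y; have := nbhsx_ballx x e e0; apply: filterS => y.
  by rewrite ballEmdist.
split=> p => [|q].
  apply: continuous_big => [|q _ x]; first exact: mul_continuous.
  by apply: cvgM; [exact: cdist|exact: cvg_cst].
have vinj := venum.1.
have [<-|pq] := eqVneq p q.
  rewrite big1// => q' q'p; rewrite divff// gt_eqF// mdist_gt0.
  by apply: contraNneq q'p => /vinj ->.
by rewrite (bigD1 q) 1?eq_sym//= mdistxx mul0r mul0r.
Unshelve. all: by end_near. Qed.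

(** Interpolating the differences with [u p0], rather than the values of [u], gives a deviation
    controlled by the energy alone. *)
Lemma V0_interpolation : exists2 B : (K -> R) -> K -> R,
  (forall u, continuous (B u) /\ forall x, V0 x -> B u x = u x) &
  exists2 C, 0 <= C & forall u x, `|B u x - u p0| <= C * Num.sqrt (E 0 u).
Proof.
have [chi [cchi chiv]] := bump_functions.
exists (fun u x => u p0 + \sum_p (u (v p) - u p0) * chi p x) => [u|].
  split=> [x|x xV].
    apply: cvgD; first exact: cvg_cst.
    apply: (continuous_big (op := +%R)) => [|p _ y]; first exact: add_continuous.
    by apply: cvgM; [exact: cvg_cst|exact: cchi].
  case: venum => _ vV; move: xV; rewrite -vV => -[p _ <-].
  rewrite (bigD1 p)//= big1 ?addr0 => [|q qp]; last first.
    by rewrite chiv (negbTE qp) mulr0.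
  by rewrite chiv eqxx mulr1 addrC subrK.
have [C C0 HC] := poincare_V0.
have /choice[b bP] : forall p, exists b, 0 <= b /\ forall x, `|chi p x| <= b.
  by move=> p; have [b b0 bP] := continuous_bounded sss (cchi p); exists b.
exists (\sum_p C * b p) => [|u x].
  by rewrite sumr_ge0// => p _; rewrite mulr_ge0//; case: (bP p).
rewrite addrAC subrr add0r mulr_suml (le_trans (ler_norm_sum _ _ _))// ler_sum// => p _.
have [b0 chib] := bP p.
by rewrite normrM mulrAC ler_pM// HC//; exact: V0_v.
Qed.

Lemma sqrt_energy_step u i rho : 0 <= rho -> r i <= rho ^+ 2 ->
  Num.sqrt (E 0 (harmonic_step u \o F i)) <= rho * Num.sqrt (E 0 u).
Proof.
move=> rho0 ri; rewrite -[X in X * _]ger0_norm// -sqrtr_sqr -sqrtrM ?sqr_ge0//.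
apply: ler_wsqrtr; rewrite (le_trans (energy_m_cell hs 0 i _))//.
rewrite ler_pM ?(energy_m_ge0 hs) ?harmonic_step_energy//.
by rewrite ltW// (hs_weight_gt0 hs).
Qed.

Lemma harmonic_extension : exists2 psi : (K -> R) -> K -> R,
  (forall u, [/\ continuous (psi u), forall x, V0 x -> psi u x = u x &
     forall k, E k (psi u) <= E 0 u]) &
  exists2 C, 0 <= C & forall u x, `|psi u x - u p0| <= C * Num.sqrt (E 0 u).
Proof.
have [rho rho01 rrho] := weight_sqr_lt1; have /andP[rho0 rho1] := rho01.
have [B BP [b b0 Bb]] := V0_interpolation.
have [C C0 HC] := harmonic_step_osc.
pose h := cell_iter sss B harmonic_step.
have BV0 u x : V0 x -> B u x = u x by apply: (BP u).2.
have hV0 m u x : V0 x -> h m u x = u x.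
  by apply: cell_iter_V0 => // *; exact: harmonic_step_V0.
have hS m u i x : h m.+1 u (F i x) = h m (harmonic_step u \o F i) x.
  exact: (congr1 (fun f => f x) (cell_iterS sss BV0 harmonic_step_V0 m u i)).
have hcont m u : continuous (h m u).
  apply: (@cell_iter_continuous _ _ _ _ _ sss _ _ _ _ (fun=> True)) => // *.
    exact: harmonic_step_V0.
  exact: (BP _).1.
(* On a cell: from the interpolation of the harmonic step to its value at the base point ([b]), from
   there to [u p0] ([C]), and back to the interpolation of [u] ([b]). *)
pose A := b + C + b; have A0 : 0 <= A by rewrite !addr_ge0.
have hdist m u x : `|h m.+1 u x - h m u x| <= A * Num.sqrt (E 0 u) * rho ^+ m.
  elim: m u x => [|m IH] u x.
    rewrite expr0 mulr1 -(cell_preimageK sss x) hS.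
    set i := cell_index sss x; set y := cell_preimage sss x.
    set s := Num.sqrt _; set w := harmonic_step u \o F i.
    rewrite /A !mulrDl -addrA (le_trans (ler_distD (w p0) _ _))// lerD//.
      rewrite (le_trans (Bb w y))// ler_wpM2l//.
      rewrite (le_trans (sqrt_energy_step u rho0 (rrho i)))// ler_piMl ?sqrtr_ge0//.
      exact: ltW.
    rewrite (le_trans (ler_distD (u p0) _ _))// lerD//; first exact: HC.
    by rewrite distrC; exact: Bb.
  rewrite -(cell_preimageK sss x) !(hS _ u) (le_trans (IH _ _))//.
  rewrite exprS mulrA ler_wpM2r ?exprn_ge0// -mulrA ler_wpM2l// mulrC.
  exact: sqrt_energy_step.
have lim u x : exists l, forall m,
    `|l - h m u x| <= A * Num.sqrt (E 0 u) / (1 - rho) * rho ^+ m.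
  exact: geometric_limit rho01 (fun m => hdist m u x).
pose psi u x := projT1 (cid (lim u x)).
have psiP u x m : `|psi u x - h m u x| <= A * Num.sqrt (E 0 u) / (1 - rho) * rho ^+ m.
  exact: (projT2 (cid (lim u x))).
have psiV0 u x : V0 x -> psi u x = u x.
  move=> xV; apply/eqP; rewrite -subr_eq0; apply/eqP.
  by apply: (exprn_small rho01) => m; rewrite -[X in _ - X](hV0 m u x xV); exact: psiP.
have psiF u i x : psi u (F i x) = psi (harmonic_step u \o F i) x.
  apply/eqP; rewrite -subr_eq0; apply/eqP.
  apply: (exprn_small rho01 (c := A * Num.sqrt (E 0 u) / (1 - rho) * rho +
    A * Num.sqrt (E 0 (harmonic_step u \o F i)) / (1 - rho))) => m.
  rewrite (le_trans (ler_distD (h m.+1 u (F i x)) _ _))// mulrDl lerD//.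
    by have := psiP u (F i x) m.+1; rewrite exprS mulrA.
  by rewrite hS distrC.
exists psi => [u|].
  split=> [x||k].
  - have cvg0 : A * Num.sqrt (E 0 u) / (1 - rho) * rho ^+ m @[m --> \oo] --> (0 : R).
      rewrite -[X in _ --> X](mulr0 (A * Num.sqrt (E 0 u) / (1 - rho))).
      by apply: cvgMl_tmp; apply: cvg_expr; rewrite ger0_norm.
    apply/cvgrPdist_lt => e e0.
    have e30 : 0 < e / 3 by rewrite divr_gt0.
    move/cvgrPdist_lt : cvg0 => /(_ _ e30)[m _ /(_ m (leqnn m))/= hm].
    have {}hm y : `|psi u y - h m u y| < e / 3.
      by rewrite (le_lt_trans (psiP u y m))// (le_lt_trans (ler_norm _))// -normrN -sub0r.
    have := hcont m u x => /cvgrPdist_lt/(_ _ e30); apply: filterS => y xy.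
    rewrite (le_lt_trans (ler_distD (h m u x) _ _))//.
    rewrite (@lt_le_trans _ _ (e / 3 + (e / 3 + e / 3)))//; last by lra.
    rewrite ltrD// (le_lt_trans (ler_distD (h m u y) _ _))// ltrD//.
    by rewrite distrC.
  - exact: psiV0.
  elim: k u => [|k IH] u; first by rewrite (energy_m0_V0 (f := u)) //; exact: psiV0.
  rewrite energy_mS (le_trans _ (harmonic_step_energy u))// energy_mS ler_sum// => i _.
  rewrite ler_wpM2l//.
  have -> : psi u \o F i = psi (harmonic_step u \o F i).
    by apply/funext => x; exact: psiF.
  exact: IH.
exists (A / (1 - rho) + b) => [|u x].
  by rewrite addr_ge0// divr_ge0// subr_ge0 ltW.
rewrite mulrDl (le_trans (ler_distD (h 0%N u x) _ _))// lerD//.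
by rewrite (le_trans (psiP u x 0%N))// expr0 mulr1 mulrAC.
Qed.

Lemma finite_energy_dense u eps : continuous u -> 0 < eps ->
  exists f : K -> R, [/\ continuous f, exists M, forall k, E k f <= M &
    forall x, `|f x - u x| <= eps].
Proof.
move=> cu eps0.
have [psi psiP [C C0 HC]] := harmonic_extension.
have [c c0 Hc] := quad_form_ub (hs_laplacian hs).
have psiV0 f x : V0 x -> psi f x = f x by case: (psiP f) => _ + _; apply.
(* Nothing is changed on levels 0 to m - 1, and [psi] is applied in each cell of level [m], where it
   keeps the boundary values, so that the pieces fit together. *)
pose h := cell_iter sss psi id.
have hS m f i : h m.+1 f \o F i = h m (f \o F i).
  by apply: cell_iterS.
have hE m f : exists M, forall k, E k (h m f) <= M.
  elim: m f => [|m IH] f.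
    by exists (E 0 f) => k; case: (psiP f).
  have /choice[M MP] : forall i, exists M, forall k, E k (h m (f \o F i)) <= M.
    by move=> i; exact: IH.
  exists (\sum_i (r i)^-1 * M i); apply: (energy_m_le hs); exists 1%N => -[//|k] _.
  by rewrite energy_mS ler_sum// => i _; rewrite ler_wpM2l// hS.
have hcont m f : continuous f -> continuous (h m f).
  apply: (@cell_iter_continuous _ _ _ _ _ sss _ _ _ _ (fun g => continuous g)) => //.
    by move=> g _; case: (psiP g).
  move=> g i cg x; apply: continuous_comp; last exact: cg.
  exact: (sss_continuous sss).
(* In a cell of oscillation at most [d] the boundary energy is at most c d^2. Hence [psi] stays
   within C sqrt(c) d of the value at the base point, which is within [d] of the function. *)
have hdist m f d x : cell_osc_le F m f d ->
    `|h m f x - f x| <= (C * Num.sqrt c + 1) * d.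
  elim: m f x => [|m IH] f x fd.
    have d0 : 0 <= d by rewrite (le_trans _ (fd p0 p0)).
    rewrite (le_trans (ler_distD (f p0) _ _))// mulrDl mul1r lerD//.
    rewrite (le_trans (HC f x))// -mulrA ler_wpM2l//.
    rewrite -[X in _ * X]ger0_norm// -sqrtr_sqr -sqrtrM//; apply: ler_wsqrtr.
    by rewrite energy_m0 Hc// => i j; rewrite !mxE.
  rewrite -(cell_preimageK sss x).
  rewrite -[h _ _ _]/((h m.+1 f \o F _) _) hS.
  exact: (IH _ _ (fd _)).
have k0 : 0 < C * Num.sqrt c + 1.
  by rewrite ltr_wpDl// mulr_ge0// sqrtr_ge0.
have [m um] := continuous_cell_osc sss cu (divr_gt0 eps0 k0).
exists (h m u); split=> [||x]; [exact: hcont|exact: hE|].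
by rewrite (le_trans (hdist _ _ _ _ um))// mulrC divfK// gt_eqF.
Qed.

End RegularStructure.

(** * Complex-valued functions *)

(* Norms over [R[i]] are [R[i]]-valued: this is their real value. *)
Definition rnorm (R : realType) (V : normedZmodType R[i]) (x : V) : R :=
  complex.Re `|x|.

Section RealNorm.
Context {R : realType} {V : normedZmodType R[i]}.
Implicit Types (x y : V) (z : R[i]).

Lemma rnormE x : `|x| = (rnorm x)%:C%C.
Proof. by rewrite /rnorm RRe_real// normr_real. Qed.

Lemma rnorm_ge0 x : 0 <= rnorm x.
Proof. by rewrite -lecR -rnormE; exact: normr_ge0. Qed.

Lemma rnormD x y : rnorm (x + y) <= rnorm x + rnorm y.
Proof. by rewrite -lecR rmorphD /= -!rnormE ler_normD. Qed.

Lemma rnormN x : rnorm (- x) = rnorm x.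
Proof. by rewrite /rnorm normrN. Qed.

Lemma rnormB x y : rnorm (x - y) <= rnorm x + rnorm y.
Proof. by rewrite (le_trans (rnormD _ _))// rnormN. Qed.

Lemma rnorm0 : rnorm (0 : V) = 0.
Proof. by rewrite /rnorm normr0. Qed.

Lemma rnorm_eq0 x : rnorm x = 0 -> x = 0.
Proof. by move=> x0; apply/normr0_eq0; rewrite rnormE x0. Qed.

Lemma ler_rnorm_sum (I : Type) (s : seq I) (f : I -> V) :
  rnorm (\sum_(i <- s) f i) <= \sum_(i <- s) rnorm (f i).
Proof.
elim/big_rec2: _ => [|i a b _ ab]; first by rewrite rnorm0.
by rewrite (le_trans (rnormD _ _))// lerD2l.
Qed.

End RealNorm.

Section ComplexModulus.
Context {R : realType}.
Implicit Type z : R[i].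

Lemma rnorm_sqr z : rnorm z ^+ 2 = complex.Re z ^+ 2 + complex.Im z ^+ 2.
Proof. by rewrite /rnorm normc_def/= sqr_sqrtr// addr_ge0 ?sqr_ge0. Qed.

Lemma rnorm_real (a : R) : rnorm (a%:C%C) = `|a|.
Proof. by rewrite /rnorm normc_def/= expr0n addr0 sqrtr_sqr. Qed.

Lemma rnorm_conj z : rnorm z^* = rnorm z.
Proof. by rewrite /rnorm norm_conjC. Qed.

Lemma normr_Re_le z : `|complex.Re z| <= rnorm z.
Proof.
rewrite -(ger0_norm (rnorm_ge0 z)) -ler_sqr ?nnegrE// !real_normK ?num_real//.
by rewrite rnorm_sqr lerDl sqr_ge0.
Qed.

Lemma normr_Im_le z : `|complex.Im z| <= rnorm z.
Proof.
rewrite -(ger0_norm (rnorm_ge0 z)) -ler_sqr ?nnegrE// !real_normK ?num_real//.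
by rewrite rnorm_sqr lerDr sqr_ge0.
Qed.

Lemma rnorm_le_ReIm z : rnorm z <= `|complex.Re z| + `|complex.Im z|.
Proof.
rewrite -ler_sqr ?nnegrE ?rnorm_ge0 ?addr_ge0// rnorm_sqr sqrrD.
by rewrite !real_normK ?num_real// addrAC lerDl mulrn_wge0// mulr_ge0.
Qed.

Lemma Re_conj z : complex.Re z^* = complex.Re z.
Proof. by case: z. Qed.

Lemma Im_conj z : complex.Im z^* = - complex.Im z.
Proof. by case: z. Qed.

Lemma mul_conjE z : z * z^* = (rnorm z ^+ 2)%:C%C.
Proof. by rewrite -normCK rnormE rmorphXn. Qed.

Lemma Re_mul (x y : R[i]) :
  complex.Re (x * y) = complex.Re x * complex.Re y - complex.Im x * complex.Im y.
Proof. by case: x; case: y. Qed.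

Lemma Im_mul (x y : R[i]) :
  complex.Im (x * y) = complex.Re x * complex.Im y + complex.Im x * complex.Re y.
Proof. by case: x; case: y. Qed.

Lemma Re_add (x y : R[i]) : complex.Re (x + y) = complex.Re x + complex.Re y.
Proof. by case: x; case: y. Qed.

Lemma Im_add (x y : R[i]) : complex.Im (x + y) = complex.Im x + complex.Im y.
Proof. by case: x; case: y. Qed.

Lemma Re_opp (x : R[i]) : complex.Re (- x) = - complex.Re x.
Proof. by case: x. Qed.

Lemma Im_opp (x : R[i]) : complex.Im (- x) = - complex.Im x.
Proof. by case: x. Qed.

Lemma gtc0E (e : R[i]) : 0 < e -> 0 < complex.Re e /\ e = (complex.Re e)%:C%C.
Proof.
move=> e0; have eE : e = (complex.Re e)%:C%C.
  by rewrite RRe_real// realE ltW.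
by split=> //; rewrite -ltcR -eE.
Qed.

End ComplexModulus.

Section ContinuousComplex.
Context {R : realType} {K : topologicalType}.
Implicit Types a b : K -> R[i].

Lemma continuousCP a : continuousC a <->
  continuous (fun x => complex.Re (a x)) /\ continuous (fun x => complex.Im (a x)).
Proof.
split=> [ca|[cr ci] x].
  split=> x; apply/cvgrPdist_lt => e e0.
    have := ca x => /cvgrPdist_lt/(_ e%:C%C); rewrite ltcR => /(_ e0).
    apply: filterS => y; rewrite rnormE ltcR; apply: le_lt_trans.
    by rewrite -Re_opp -Re_add normr_Re_le.
  have := ca x => /cvgrPdist_lt/(_ e%:C%C); rewrite ltcR => /(_ e0).
  apply: filterS => y; rewrite rnormE ltcR; apply: le_lt_trans.
  by rewrite -Im_opp -Im_add normr_Im_le.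
apply/cvgrPdist_lt => e /gtc0E[e0 ->].
have e20 : 0 < complex.Re e / 2 by rewrite divr_gt0.
have := ci x => /cvgrPdist_lt/(_ _ e20); have := cr x => /cvgrPdist_lt/(_ _ e20).
apply: filterS2 => y yr yi; rewrite rnormE ltcR.
rewrite (le_lt_trans (rnorm_le_ReIm _))// (splitr (complex.Re e)).
by rewrite Re_add Im_add Re_opp Im_opp ltrD.
Qed.

Lemma continuousC_comb c a b : continuousC a -> continuousC b ->
  continuousC (fun x => c * a x + b x).
Proof.
move=> ca cb x; apply: cvgD; last exact: cb.
by apply: cvgM; [exact: cvg_cst|exact: ca].
Qed.

Lemma continuousCM a b : continuousC a -> continuousC b ->
  continuousC (fun x => a x * b x).
Proof. by move=> ca cb x; apply: cvgM; [exact: ca|exact: cb]. Qed.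

Lemma continuousC_cst c : continuousC (fun _ : K => c : R[i]).
Proof. by move=> x; exact: cvg_cst. Qed.

Lemma continuousC_conj a : continuousC a -> continuousC (fun x => (a x)^*).
Proof.
move=> /continuousCP[cr ci]; apply/continuousCP; split=> x.
  by under eq_fun do rewrite Re_conj; exact: cr.
by under eq_fun do rewrite Im_conj; apply: cvgN; exact: ci.
Qed.

Lemma continuousC_real (f : K -> R) : continuous f ->
  continuousC (fun x => (f x)%:C%C).
Proof. by move=> cf; apply/continuousCP; split=> //= x; exact: cvg_cst. Qed.

Lemma continuous_rnorm_sqr a : continuousC a -> continuous (fun x => rnorm (a x) ^+ 2).
Proof.
move=> /continuousCP[cr ci] x; under eq_fun do rewrite rnorm_sqr !expr2.
by apply: cvgD; apply: cvgM; first [exact: cr|exact: ci].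
Qed.

End ContinuousComplex.

(** * The form domain as a dense subalgebra of C(K) *)

Section FormDomain.
Context {R : realType} {K : metricType R} {N : nat}.
Context {F : 'I_N -> K -> K} {coding : code_space N -> K}.
Context {n : nat} {v : 'I_n -> K} {D : 'M[R]_n} {r : 'I_N -> R}.
Hypothesis sss : self_similar_structure F coding.
Hypothesis venum : enumerates v (V0 F coding).
Hypothesis rhs : regular_harmonic_structure F coding v D r.
Local Notation E := (energy_m F v D r).
Local Notation dom := (form_domain F v D r).
Local Notation fe := (finite_energy F v D r).
Local Notation en := (energy F v D r).
Implicit Types (u f g : K -> R) (a b : K -> R[i]).
Let hs := rhs_harmonic rhs.

Lemma finite_energyD u f : fe u -> fe f -> fe (fun x => u x + f x).
Proof.
move=> /(finite_energyP hs)[M uM] /(finite_energyP hs)[M' fM].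
apply/(finite_energyP hs); exists (2 * M + 2 * M') => m.
by rewrite (le_trans (energy_mD hs m u f))// lerD// ler_wpM2l.
Qed.

Lemma finite_energyZ c u : fe u -> fe (fun x => c * u x).
Proof.
move=> /(finite_energyP hs)[M uM].
apply/(finite_energyP hs); exists (c ^+ 2 * M) => m.
by rewrite (le_trans (energy_mZ hs m c u))// ler_wpM2l// sqr_ge0.
Qed.

Lemma finite_energyN u : fe u -> fe (fun x => - u x).
Proof. by move=> /(finite_energyZ (c := -1)); under eq_fun do rewrite mulN1r. Qed.

Lemma finite_energyM u f : continuous u -> continuous f -> fe u -> fe f ->
  fe (fun x => u x * f x).
Proof.
move=> cu cf /(finite_energyP hs)[M uM] /(finite_energyP hs)[M' fM].
have [A A0 uA] := continuous_bounded sss cu.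
have [B B0 fB] := continuous_bounded sss cf.
apply/(finite_energyP hs); exists (2 * B ^+ 2 * M + 2 * A ^+ 2 * M') => m.
rewrite (le_trans (energy_mM hs m uA fB))// lerD// ler_wpM2l//.
  by rewrite mulr_ge0// sqr_ge0.
by rewrite mulr_ge0// sqr_ge0.
Qed.

Lemma form_domain_continuous a : dom a -> continuousC a. Proof. by case. Qed.

Lemma form_domain_comb c a b : dom a -> dom b -> dom (fun x => c * a x + b x).
Proof.
move=> [ca ra ia] [cb rb ib]; split; first exact: continuousC_comb.
  under eq_fun do rewrite Re_add Re_mul.
  by apply: finite_energyD => //; apply: finite_energyD; [|apply: finite_energyN];
    exact: finite_energyZ.
under eq_fun do rewrite Im_add Im_mul.
by apply: finite_energyD => //; apply: finite_energyD; exact: finite_energyZ.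
Qed.

Lemma form_domainM a b : dom a -> dom b -> dom (fun x => a x * b x).
Proof.
move=> [ca ra ia] [cb rb ib]; split; first exact: continuousCM.
  have [[? ?] [? ?]] := ((continuousCP a).1 ca, (continuousCP b).1 cb).
  under eq_fun do rewrite Re_mul.
  by apply: finite_energyD; [|apply: finite_energyN]; exact: finite_energyM.
have [[? ?] [? ?]] := ((continuousCP a).1 ca, (continuousCP b).1 cb).
under eq_fun do rewrite Im_mul.
by apply: finite_energyD; exact: finite_energyM.
Qed.

Lemma form_domain_conj a : dom a -> dom (fun x => (a x)^*).
Proof.
move=> [ca ra ia]; split; first exact: continuousC_conj.
  by under eq_fun do rewrite Re_conj.
by under eq_fun do rewrite Im_conj; exact: finite_energyN.
Qed.

Lemma form_domain0 : dom (fun=> 0).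
Proof.
split; first exact: continuousC_cst.
  by apply/(finite_energyP hs); exists 0 => m; rewrite (energy_m_const rhs _ (c := 0)).
by apply/(finite_energyP hs); exists 0 => m; rewrite (energy_m_const rhs _ (c := 0)).
Qed.

Lemma form_domain_sum (I : Type) (s : seq I) (c : I -> R[i]) (b : I -> K -> R[i]) :
  (forall i, dom (b i)) -> dom (fun x => \sum_(i <- s) c i * b i x).
Proof.
move=> domb; elim: s => [|i s IH].
  by under eq_fun do rewrite big_nil; exact: form_domain0.
by under eq_fun do rewrite big_cons; exact: form_domain_comb.
Qed.

(** This settles the case of an empty V_0, which offers no base point for the constructions above:
    every continuous function then lies in the form domain and has zero energy. *)
Lemma energy_m_dim0 m u : n = 0%N -> E m u = 0.
Proof.
move=> n0; rewrite /energy_m big1// => w _; rewrite [quad_form _ _]big1 ?mulr0//.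
by move=> [p pn]; exfalso; move: pn; rewrite n0.
Qed.

Lemma energy_eq0 a : (forall m, E m (fun x => complex.Re (a x)) = 0) ->
  (forall m, E m (fun x => complex.Im (a x)) = 0) -> en a = 0.
Proof.
move=> r0 i0; rewrite /energy (_ : energy_m _ _ _ _ ^~ _ = fun=> 0); last exact/funext.
rewrite (_ : energy_m _ _ _ _ ^~ _ = fun=> 0); last exact/funext.
by rewrite lim_cst// addr0.
Qed.

Lemma energy_m_le_energy a m : dom a ->
  E m (fun x => complex.Re (a x)) <= en a /\ E m (fun x => complex.Im (a x)) <= en a.
Proof.
move=> [_ ra ia]; have r_ge := finite_energy_ub hs ra; have i_ge := finite_energy_ub hs ia.
have := r_ge m; have := i_ge m; have := energy_m_ge0 hs m.
move=> e0 im rm; rewrite /energy; split.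
  by rewrite (le_trans rm)// lerDl (le_trans (e0 _) im).
by rewrite (le_trans im)// lerDr (le_trans (e0 _) rm).
Qed.

Lemma energy_ge0 a : dom a -> 0 <= en a.
Proof.
move=> /(energy_m_le_energy 0)[+ _]; apply: le_trans; exact: (energy_m_ge0 hs).
Qed.

Lemma form_domain_dense a eps : continuousC a -> 0 < eps ->
  exists2 b, dom b & forall x, rnorm (a x - b x) <= eps.
Proof.
move=> /continuousCP[cr ci] eps0.
have dense u : continuous u ->
    exists f : K -> R, [/\ continuous f, fe f & forall x, `|f x - u x| <= eps / 2].
  move=> cu; have [n0|n0] := posnP n; last first.
    have [f [cf Ef fu]] := finite_energy_dense sss venum rhs (Ordinal n0) cu
      (divr_gt0 eps0 (ltr0n _ 2)).
    by exists f; split=> //; exact/(finite_energyP hs).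
  exists u; split=> // [|x]; last by rewrite subrr normr0 divr_ge0// ltW.
  by apply/(finite_energyP hs); exists 0 => m; rewrite energy_m_dim0.
have [f [cf fef fr]] := dense _ cr; have [g [cg feg gi]] := dense _ ci.
exists (fun x => (f x +i* g x)%C) => [|x]; first by split=> //; exact/continuousCP.
rewrite (le_trans (rnorm_le_ReIm _))// Re_add Im_add Re_opp Im_opp (splitr eps).
by apply: lerD; rewrite distrC; [exact: fr|exact: gi].
Qed.

(* Subtracting from the [b i] functions of zero energy, one makes all their linear
   combinations uniformly controlled by the energy. *)
Lemma uniform_representatives : exists2 G, 0 <= G &
  forall (I : eqType) (s : seq I) (b : I -> K -> R[i]) (eps : R),
  (forall i, dom (b i)) -> 0 < eps ->
  exists b' : I -> K -> R[i],
  [/\ forall i, dom (b' i),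
      forall i, en (fun x => b' i x - b i x) = 0 &
      forall (c : I -> R[i]) x, rnorm (\sum_(i <- s) c i * b' i x) <=
        G * Num.sqrt (en (fun x => \sum_(i <- s) c i * b i x)) +
        eps * \sum_(i <- s) rnorm (c i)].
Proof.
have [n0|n0] := posnP n.
  exists 0 => // I s b eps domb eps0; exists (fun _ _ => 0); split=> [i|i|c x].
  - exact: form_domain0.
  - by apply: energy_eq0 => m; exact: energy_m_dim0.
  - rewrite big1 => [|i _]; last by rewrite mulr0.
    rewrite rnorm0 mul0r add0r mulr_ge0 ?(ltW eps0)// sumr_ge0// => i _.
    exact: rnorm_ge0.
pose o := Ordinal n0; pose p0 := v o.
have [G G0 HG] := corrected_bound sss venum rhs o.
exists (G + G) => [|I s b eps domb eps0]; first exact: addr_ge0.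
(* The real part of c b involves both parts of b, and so does the imaginary part: four contributions
   in all. *)
have d0 : 0 < eps / 4 by rewrite divr_gt0.
have /choice[m mP] : forall i, exists m,
    cell_osc_le F m (fun x => complex.Re (b i x)) (eps / 4) /\
    cell_osc_le F m (fun x => complex.Im (b i x)) (eps / 4).
  move=> i; have [/continuousCP[cr ci] _ _] := domb i.
  have [m1 m1P] := continuous_cell_osc sss cr d0.
  have [m2 m2P] := continuous_cell_osc sss ci d0.
  exists (maxn m1 m2); split; first exact: cell_osc_le_mono (leq_maxl _ _) m1P.
  exact: cell_osc_le_mono (leq_maxr _ _) m2P.
(* A common level for the family makes the correction a single linear map [L], normalized by
   subtracting the value at [p0]. *)
pose M := (\max_(i <- s) m i)%N.
pose L u x := corrected (v := v) sss o M u x - u p0.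
pose LC a x := (L (fun y => complex.Re (a y)) x +i* L (fun y => complex.Im (a y)) x)%C.
have Llin c u f x : L (fun y => c * u y + f y) x = c * L u x + L f x.
  by rewrite /L (corrected_linear sss venum rhs); ring.
have LClin c a a' x : LC (fun y => c * a y + a' y) x = c * LC a x + LC a' x.
  rewrite /LC; apply/eqP; rewrite eq_complex Re_add Im_add Re_mul Im_mul /=.
  have -> : (fun y => complex.Re (c * a y + a' y)) = (fun y => complex.Re c * complex.Re (a y) +
      (- complex.Im c * complex.Im (a y) + complex.Re (a' y))).
    by apply/funext => y; rewrite Re_add Re_mul; ring.
  have -> : (fun y => complex.Im (c * a y + a' y)) = (fun y => complex.Re c * complex.Im (a y) +
      (complex.Im c * complex.Re (a y) + complex.Im (a' y))).
    by apply/funext => y; rewrite Im_add Im_mul; ring.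
  by rewrite !Llin; apply/andP; split; apply/eqP; ring.
have LC0 x : LC (fun=> 0) x = 0.
  have := LClin 1 (fun=> 0) (fun=> 0) x; under eq_fun do rewrite mulr0 addr0.
  by rewrite mul1r => /eqP; rewrite -subr_eq subrr eq_sym => /eqP.
have LCsum (c : I -> R[i]) x t :
    LC (fun y => \sum_(i <- t) c i * b i y) x = \sum_(i <- t) c i * LC (b i) x.
  elim: t => [|i t IH]; first by under eq_fun do rewrite big_nil; rewrite big_nil LC0.
  by under eq_fun do rewrite big_cons; rewrite big_cons -IH LClin.
have osc (c : I -> R[i]) t : {subset t <= s} ->
    cell_osc_le F M (fun y => complex.Re (\sum_(i <- t) c i * b i y))
      (eps / 2 * \sum_(i <- t) rnorm (c i)) /\
    cell_osc_le F M (fun y => complex.Im (\sum_(i <- t) c i * b i y))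
      (eps / 2 * \sum_(i <- t) rnorm (c i)).
  elim: t => [|i t IH] ts.
    have osc0 : cell_osc_le F M (fun=> 0) (0 : R).
      by apply: (@cell_osc_le_mono _ _ _ _ 0%N) => // x y; rewrite subrr normr0.
    by rewrite big_nil mulr0; split; under eq_fun do rewrite big_nil.
  have [ri ii] : cell_osc_le F M (fun x => complex.Re (b i x)) (eps / 4) /\
      cell_osc_le F M (fun x => complex.Im (b i x)) (eps / 4).
    have iM : (m i <= M)%N by apply: leq_bigmax_seq => //; apply: ts; exact: mem_head.
    by have [rm im] := mP i; split; apply: cell_osc_le_mono iM _.
  have [|rt it] := IH; first by move=> j jt; apply: ts; rewrite inE jt orbT.
  rewrite big_cons; set S := (\sum_(j <- t) rnorm (c j)) in rt it *.
  have -> : eps / 2 * (rnorm (c i) + S) =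
      rnorm (c i) * (eps / 4) + (rnorm (c i) * (eps / 4) + eps / 2 * S).
    by field.
  have comb (z z' w w' k : R) : `|k| <= rnorm (c i) ->
      k * z + w - (k * z' + w') = k * (z - z') + (w - w') ->
      `|k * z + w - (k * z' + w')| <= rnorm (c i) * `|z - z'| + `|w - w'|.
    move=> kc ->; rewrite (le_trans (ler_normD _ _))// lerD2r normrM.
    by rewrite ler_wpM2r.
  split.
    apply: (cell_osc_le_comb (f := fun x => complex.Re (b i x))
      (g := fun x => - complex.Im (c i) * complex.Im (b i x) +
         complex.Re (\sum_(j <- t) c j * b j x))) => //.
    - move=> x y; have rw z : complex.Re (\sum_(j <- i :: t) c j * b j z) =
          complex.Re (c i) * complex.Re (b i z) + (- complex.Im (c i) *
          complex.Im (b i z) + complex.Re (\sum_(j <- t) c j * b j z)).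
        by rewrite big_cons Re_add Re_mul; ring.
      by rewrite !rw; apply: comb; [exact: normr_Re_le|ring].
    - exact: rnorm_ge0.
    apply: (cell_osc_le_comb _ _ ii rt); last exact: rnorm_ge0.
    by move=> x y; apply: comb; [rewrite normrN; exact: normr_Im_le|ring].
  apply: (cell_osc_le_comb (f := fun x => complex.Im (b i x))
    (g := fun x => complex.Im (c i) * complex.Re (b i x) +
       complex.Im (\sum_(j <- t) c j * b j x))) => //.
  - move=> x y; have rw z : complex.Im (\sum_(j <- i :: t) c j * b j z) =
        complex.Re (c i) * complex.Im (b i z) + (complex.Im (c i) *
        complex.Re (b i z) + complex.Im (\sum_(j <- t) c j * b j z)).
      by rewrite big_cons Im_add Im_mul; ring.
    by rewrite !rw; apply: comb; [exact: normr_Re_le|ring].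
  - exact: rnorm_ge0.
  apply: (cell_osc_le_comb _ _ ri it); last exact: rnorm_ge0.
  by move=> x y; apply: comb; [exact: normr_Im_le|ring].
have Lcont u : continuous u -> continuous (L u).
  move=> cu x; apply: cvgB; last exact: cvg_cst.
  exact: (@corrected_continuous _ _ _ _ _ _ _ _ _ sss venum rhs o M u cu x).
have LE u k : E k (fun x => L u x - u x) = 0.
  rewrite -(energy_m_corrected sss venum rhs o k M u).
  by apply: (energy_m_shift hs _ (c := - u p0)) => x; rewrite /L; ring.
have Lfe u : fe u -> fe (L u).
  move=> feu; have : fe (fun x => (L u x - u x) + u x).
    apply: finite_energyD => //; apply/(finite_energyP hs); exists 0 => k.
    by rewrite LE.
  by under eq_fun do rewrite subrK.
exists (fun i => LC (b i)); split=> [i|i|c x].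
- have [/continuousCP[cr ci] fr fi] := domb i; split; last 2 first.
  + exact: Lfe.
  + exact: Lfe.
  by apply/continuousCP; split; exact: Lcont.
- apply: energy_eq0 => k.
    by under eq_fun do rewrite Re_add Re_opp; exact: LE.
  by under eq_fun do rewrite Im_add Im_opp; exact: LE.
rewrite -LCsum; set a := fun y => \sum_(i <- s) c i * b i y.
have doma : dom a by exact: form_domain_sum.
rewrite (le_trans (rnorm_le_ReIm _))//=.
have [osr osi] := osc c s (fun i => id).
have aE : en a = Num.sqrt (en a) ^+ 2 by rewrite sqr_sqrtr// energy_ge0.
have Lr := HG _ _ _ _ (sqrtr_ge0 (en a)) _ osr x.
have Li := HG _ _ _ _ (sqrtr_ge0 (en a)) _ osi x.
set Gs := G * Num.sqrt (en a) in Lr Li *.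
have -> : (G + G) * Num.sqrt (en a) + eps * \sum_(i <- s) rnorm (c i) =
    (Gs + eps / 2 * \sum_(i <- s) rnorm (c i)) +
    (Gs + eps / 2 * \sum_(i <- s) rnorm (c i)).
  by rewrite /Gs; field.
apply: lerD.
  by apply: Lr => k; rewrite -aE; case: (energy_m_le_energy k doma).
by apply: Li => k; rewrite -aE; case: (energy_m_le_energy k doma).
Qed.

End FormDomain.

(** * Hilbert-Schmidt operators *)

Definition linear_subspace (R : realType) (H : normedModType R[i]) (M : set H) : Prop :=
  M 0 /\ forall c x y, M x -> M y -> M (c *: x + y).

Section InnerProduct.
Context {R : realType} {H : completeNormedModType R[i]} {ip : H -> H -> R[i]}.
Hypothesis ipH : inner_product ip.
Implicit Types (x y z : H) (c : R[i]) (s t : seq H) (M : set H).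

Lemma rnormZ c x : rnorm (c *: x) = rnorm c * rnorm x.
Proof. by rewrite /rnorm normrZ !rnormE -rmorphM. Qed.

Lemma rnorm_sqr_ip x : (rnorm x ^+ 2)%:C%C = ip x x.
Proof. by rewrite -(ip_norm ipH) rnormE rmorphXn. Qed.

Lemma ipDl x y z : ip (x + y) z = ip x z + ip y z.
Proof. by rewrite -[x]scale1r (ip_linear ipH) mul1r scale1r. Qed.

Lemma ip0l z : ip 0 z = 0.
Proof. by apply: (addrI (ip 0 z)); rewrite -ipDl !addr0. Qed.

Lemma ipZl c x z : ip (c *: x) z = c * ip x z.
Proof. by rewrite -[c *: x]addr0 (ip_linear ipH) ip0l addr0. Qed.

Lemma ipBl x y z : ip (x - y) z = ip x z - ip y z.
Proof. by rewrite ipDl -scaleN1r ipZl mulN1r. Qed.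

Lemma ipDr x y z : ip x (y + z) = ip x y + ip x z.
Proof.
by rewrite (ip_conj ipH (y + z)) (ip_conj ipH y) (ip_conj ipH z) ipDl rmorphD.
Qed.

Lemma ip0r x : ip x 0 = 0.
Proof. by rewrite (ip_conj ipH) ip0l rmorph0. Qed.

Lemma ipZr c x z : ip x (c *: z) = c^* * ip x z.
Proof. by rewrite (ip_conj ipH (c *: z)) (ip_conj ipH z) ipZl rmorphM. Qed.

Lemma ipBr x y z : ip x (y - z) = ip x y - ip x z.
Proof.
by rewrite (ip_conj ipH (y - z)) (ip_conj ipH y) (ip_conj ipH z) ipBl rmorphB.
Qed.

Lemma ip_suml (I : eqType) (r : seq I) (f : I -> H) z :
  ip (\sum_(i <- r) f i) z = \sum_(i <- r) ip (f i) z.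
Proof. by elim/big_rec2: _ => [|i a b _ <-]; [exact: ip0l|exact: ipDl]. Qed.

Lemma ip_sumr (I : eqType) (r : seq I) (f : I -> H) z :
  ip z (\sum_(i <- r) f i) = \sum_(i <- r) ip z (f i).
Proof. by elim/big_rec2: _ => [|i a b _ <-]; [exact: ip0r|exact: ipDr]. Qed.

Lemma ip_eq0C x y : ip x y = 0 -> ip y x = 0.
Proof. by move=> xy; rewrite (ip_conj ipH) xy rmorph0. Qed.

Lemma rnorm_conjip x y : rnorm (ip x y) = rnorm (ip y x).
Proof. by rewrite (ip_conj ipH) rnorm_conj. Qed.

Lemma rnorm_sqrD_orth x y : ip x y = 0 ->
  rnorm (x + y) ^+ 2 = rnorm x ^+ 2 + rnorm y ^+ 2.
Proof.
move=> xy; apply: (@complexI R); rewrite rmorphD/= !rnorm_sqr_ip.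
by rewrite ipDl !ipDr xy (ip_eq0C xy) addr0 add0r.
Qed.

Lemma rnorm_sqrD_le x y : rnorm (x + y) ^+ 2 <= 2 * rnorm x ^+ 2 + 2 * rnorm y ^+ 2.
Proof.
rewrite (@le_trans _ _ ((rnorm x + rnorm y) ^+ 2))//.
  by rewrite lerXn2r ?nnegrE ?addr_ge0 ?rnorm_ge0 ?rnormD.
rewrite -subr_ge0 (_ : _ - _ = (rnorm x - rnorm y) ^+ 2) ?sqr_ge0//; ring.
Qed.

(** Repetitions are excluded: an entry equal to [x] would give [ip x x] both values 0 and 1. *)
Fixpoint orthonormal_seq s : Prop :=
  if s is x :: t then
    [/\ ip x x = 1, forall y, y \in t -> ip x y = 0 & orthonormal_seq t]
  else True.

Definition seq_proj s x := \sum_(e <- s) ip x e *: e.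

Lemma ip_seq_proj s x y : orthonormal_seq s -> y \in s ->
  ip (seq_proj s x) y = ip x y.
Proof.
rewrite /seq_proj; elim: s => [//|a s IH] [a1 as0 os].
rewrite big_cons ipDl ipZl inE => /orP[/eqP->|ys].
  rewrite a1 mulr1 ip_suml big1_seq ?addr0// => e /andP[_ es].
  by rewrite ipZl (ip_eq0C (as0 e es)) mulr0.
by rewrite as0// mulr0 add0r IH.
Qed.

Lemma ip_sub_seq_proj s x y : orthonormal_seq s -> y \in s ->
  ip (x - seq_proj s x) y = 0.
Proof. by move=> os ys; rewrite ipBl ip_seq_proj// subrr. Qed.

Lemma ip_seq_proj_orth s x y : (forall e, e \in s -> ip e y = 0) ->
  ip (seq_proj s x) y = 0.
Proof.
move=> sy; rewrite ip_suml big1_seq// => e /andP[_ es].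
by rewrite ipZl sy// mulr0.
Qed.

Lemma rnorm_seq_proj s x : orthonormal_seq s ->
  rnorm (seq_proj s x) ^+ 2 = \sum_(e <- s) rnorm (ip x e) ^+ 2.
Proof.
move=> os; apply: (@complexI R); rewrite rnorm_sqr_ip {2}/seq_proj ip_sumr rmorph_sum/=.
apply: eq_big_seq => e es;
  by rewrite ipZr ip_seq_proj// mulrC mul_conjE.
Qed.

Lemma rnorm_sqr_seq_proj s x : orthonormal_seq s ->
  rnorm x ^+ 2 = rnorm (x - seq_proj s x) ^+ 2 + \sum_(e <- s) rnorm (ip x e) ^+ 2.
Proof.
move=> os; rewrite -rnorm_seq_proj// -rnorm_sqrD_orth ?subrK//.
rewrite {2}/seq_proj ip_sumr big1_seq// => e /andP[_ es].
by rewrite ipZr ip_sub_seq_proj// mulr0.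
Qed.

Lemma bessel s x : orthonormal_seq s ->
  \sum_(e <- s) rnorm (ip x e) ^+ 2 <= rnorm x ^+ 2.
Proof. by move=> os; rewrite (rnorm_sqr_seq_proj x os) lerDr sqr_ge0. Qed.

Lemma subspace_sum M (I : eqType) (r : seq I) (c : I -> R[i]) (f : I -> H) :
  linear_subspace M -> (forall i, i \in r -> M (f i)) -> M (\sum_(i <- r) c i *: f i).
Proof.
move=> [M0 MD]; elim: r => [|i r IH] Mf; first by rewrite big_nil.
rewrite big_cons; apply: MD; first by apply: Mf; exact: mem_head.
by apply: IH => j jr; apply: Mf; rewrite inE jr orbT.
Qed.

Definition normalize x := ((rnorm x)^-1)%:C%C *: x.

Lemma ip_normalize x : x != 0 -> ip (normalize x) (normalize x) = 1.
Proof.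
move=> x0; rewrite -rnorm_sqr_ip /normalize rnormZ rnorm_real ger0_norm.
  rewrite mulVf ?expr1n//; apply: contra_neq x0; exact: rnorm_eq0.
by rewrite invr_ge0 rnorm_ge0.
Qed.

Lemma normalizeK x : (rnorm x)%:C%C *: normalize x = x.
Proof.
have [->|x0] := eqVneq x 0; first by rewrite /normalize !scaler0.
rewrite /normalize scalerA -rmorphM divff ?scale1r//.
by apply: contra_neq x0; exact: rnorm_eq0.
Qed.

(** A vector depending on those already treated is dropped instead of normalized, so [t] may be
    shorter than [s]; that it spans [s] is expressed through its projection. *)
Lemma gram_schmidt M s : linear_subspace M -> (forall x, x \in s -> M x) ->
  exists t, [/\ orthonormal_seq t, forall e, e \in t -> M e &
    forall x, x \in s -> seq_proj t x = x].
Proof.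
move=> sM; have M0 := sM.1; elim: s => [|y s IH] Ms; first by exists [::].
have [|t [ot Mt ts]] := IH; first by move=> x xs; apply: Ms; rewrite inE xs orbT.
pose z := y - seq_proj t y; have [z0|z0] := eqVneq z 0.
  exists t; split=> // x; rewrite inE => /orP[/eqP->|]; last exact: ts.
  by apply/esym/eqP; rewrite -subr_eq0; exact/eqP.
have zt a : a \in t -> ip (normalize z) a = 0.
  by move=> at_; rewrite ipZl ip_sub_seq_proj// mulr0.
have zproj x : ip (seq_proj t x) (normalize z) = 0.
  by apply: ip_seq_proj_orth => a /zt; exact: ip_eq0C.
have projE x : seq_proj (normalize z :: t) x =
    ip x (normalize z) *: normalize z + seq_proj t x.
  by rewrite {1}/seq_proj big_cons.
exists (normalize z :: t); split=> [|e|x].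
- by split=> //; exact: ip_normalize.
- rewrite inE => /orP[/eqP->|]; last exact: Mt.
  rewrite -[normalize z]addr0; apply: sM.2 => //.
  rewrite /z addrC -scaleN1r; apply: sM.2; last by apply: Ms; exact: mem_head.
  exact: subspace_sum.
rewrite projE inE => /orP[/eqP->|xs]; last first.
  by rewrite -{1}(ts _ xs) zproj scale0r add0r ts.
have -> : ip y (normalize z) = (rnorm z)%:C%C.
  rewrite -[y in LHS](subrK (seq_proj t y)) ipDl zproj addr0 -/z -{1}(normalizeK z).
  by rewrite ipZl ip_normalize// mulr1.
by rewrite normalizeK subrK.
Qed.

(** For a closed subspace [M], the best [C] is the squared Hilbert-Schmidt norm of [T] restricted to
    [M]. Finite families avoid the choice of a basis and let approximation errors depend on the
    family. *)
Definition hs_le M (T : H -> H) (C : R) : Prop := forall s, orthonormal_seq s ->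
  (forall e, e \in s -> M e) -> \sum_(e <- s) rnorm (T e) ^+ 2 <= C.

(* By Gram-Schmidt the vectors [S e] are expanded along an orthonormal family [t]
   of [M]; exchanging the two sums, the coefficients are bounded by Bessel's
   inequality applied to [T g], [g] in [t]. *)
Lemma hs_le_adjoint M (S T : H -> H) (C : R) : linear_subspace M -> (forall x, M (S x)) ->
  (forall x y, M y -> ip (S x) y = ip x (T y)) -> hs_le M T C -> hs_le setT S C.
Proof.
move=> sM MS ST TC s os _.
have [x|t [ot Mt tS]] := @gram_schmidt M (map S s) sM.
  by move=> /mapP[e _ ->].
rewrite (le_trans _ (TC t ot Mt))//.
rewrite (@le_trans _ _ (\sum_(g <- t) \sum_(e <- s) rnorm (ip (T g) e) ^+ 2))//.
  rewrite exchange_big/= big_seq [leRHS]big_seq; apply: ler_sum => e es.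
  rewrite -[S e](tS _ (map_f S es)) rnorm_seq_proj// big_seq [leRHS]big_seq.
  by apply: ler_sum => g gt; rewrite ST 1?rnorm_conjip//; exact: Mt.
by apply: ler_sum => g _; exact: bessel.
Qed.

Lemma hs_le_comb (S T : H -> H) (C C' c : R) :
  hs_le setT S C -> hs_le setT T C' ->
  hs_le setT (fun x => c%:C%C *: (S x - T x)) (2 * c ^+ 2 * (C + C')).
Proof.
move=> SC TC s os sT.
rewrite (@le_trans _ _ (2 * c ^+ 2 * (\sum_(e <- s) rnorm (S e) ^+ 2 +
    \sum_(e <- s) rnorm (T e) ^+ 2)))//; last first.
  apply: ler_wpM2l; first by rewrite mulr_ge0// sqr_ge0.
  by apply: lerD; [exact: SC|exact: TC].
rewrite -big_split mulr_sumr ler_sum// => e _ /=.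
rewrite rnormZ rnorm_real exprMn real_normK ?num_real//.
have := rnorm_sqrD_le (S e) (- T e); rewrite rnormN => ST.
rewrite (_ : 2 * c ^+ 2 * _ = c ^+ 2 *
  (2 * rnorm (S e) ^+ 2 + 2 * rnorm (T e) ^+ 2)); last by ring.
by rewrite ler_wpM2l ?sqr_ge0.
Qed.

Lemma rnorm_bounded_continuous (T : H -> H) (C : R) : linear T ->
  (forall x, rnorm (T x) <= C * rnorm x) -> continuous T.
Proof.
move=> linT TC x; apply/cvgrPdist_lt => e /gtc0E[e0 ->].
have C1 : 0 < `|C| + 1 by rewrite ltr_wpDl.
have d0 : 0 < complex.Re e / (`|C| + 1) by rewrite divr_gt0.
near=> y.
have -> : T x - T y = T (x - y).
  by rewrite -[- y]scaleN1r [x + _]addrC linT scaleN1r addrC.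
rewrite rnormE ltcR (le_lt_trans (TC _))//.
rewrite (@le_lt_trans _ _ ((`|C| + 1) * rnorm (x - y)))//.
  by rewrite ler_wpM2r ?rnorm_ge0// (le_trans (ler_norm C))// lerDl.
rewrite mulrC -ltr_pdivlMr// -ltcR -rnormE.
by near: y; apply: cvgr_dist_lt; rewrite ?ltcR.
Unshelve. all: by end_near. Qed.

End InnerProduct.

(** * Orthogonal projections and the associated reflection *)

Section OrthogonalProjection.
Context {R : realType} {H : completeNormedModType R[i]} {ip : H -> H -> R[i]}.
Hypothesis ipH : inner_product ip.
Context {M : set H} {P : H -> H}.
Hypothesis sM : linear_subspace M.
Hypothesis PM : orthogonal_projection ip P M.
Implicit Types x y z : H.

Lemma proj_in x : M (P x). Proof. by case: (PM x). Qed.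

Lemma proj_orth x y : M y -> ip (x - P x) y = 0.
Proof. by case: (PM x) => _; apply. Qed.

(** The difference of two candidates lies in [M] and is orthogonal to [M]. Linearity of [P] follows
    from this uniqueness. *)
Lemma proj_uniq x y : M y -> (forall z, M z -> ip (x - y) z = 0) -> P x = y.
Proof.
have [M0 MD] := sM.
move=> My xy; apply/eqP; rewrite -subr_eq0; apply/eqP/rnorm_eq0.
have Mz : M (P x - y).
  by rewrite addrC -scaleN1r; apply: MD => //; exact: proj_in.
have : (rnorm (P x - y) ^+ 2)%:C%C = 0 :> R[i].
  rewrite (rnorm_sqr_ip ipH).
  have -> : ip (P x - y) (P x - y) = ip ((x - y) - (x - P x)) (P x - y).
    by rewrite opprB [x - y + _]addrC addrA subrK.
  by rewrite (ipBl ipH) xy// proj_orth// subrr.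
by move=> /(@complexI R)/eqP; rewrite sqrf_eq0 => /eqP.
Qed.

Lemma proj_id x : M x -> P x = x.
Proof. by move=> Mx; apply: proj_uniq => // z _; rewrite subrr (ip0l ipH). Qed.

Lemma proj_linear : linear P.
Proof.
move=> c x y; apply: proj_uniq => [|z Mz]; first by apply: sM.2; exact: proj_in.
rewrite opprD addrACA -scalerBr (ipDl ipH) (ipZl ipH) !proj_orth//.
by rewrite mulr0 addr0.
Qed.

Lemma projD x y : P (x + y) = P x + P y.
Proof. by rewrite -[x]scale1r proj_linear !scale1r. Qed.

Lemma projB x y : P (x - y) = P x - P y.
Proof. by rewrite -scaleN1r addrC proj_linear scaleN1r addrC. Qed.

Lemma proj_selfadj x y : ip (P x) y = ip x (P y).
Proof.
have e1 : ip (P x) (y - P y) = 0.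
  by apply: (ip_eq0C ipH); apply: proj_orth; exact: proj_in.
have e2 : ip (x - P x) (P y) = 0 by apply: proj_orth; exact: proj_in.
rewrite -[y in LHS](subrK (P y)) (ipDr ipH) e1 add0r.
by rewrite -[x in RHS](subrK (P x)) (ipDl ipH) e2 add0r.
Qed.

Lemma proj_pythagoras x : rnorm x ^+ 2 = rnorm (P x) ^+ 2 + rnorm (x - P x) ^+ 2.
Proof.
rewrite -(rnorm_sqrD_orth ipH) ?[P x + _]addrC ?subrK//.
by apply: (ip_eq0C ipH); apply: proj_orth; exact: proj_in.
Qed.

Definition reflection x := P x - (x - P x).

Lemma reflectionE x : reflection x = 2 *: P x - x.
Proof. by rewrite /reflection opprB addrA -mulr2n -scaler_nat. Qed.

Lemma reflection_linear : linear reflection.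
Proof.
move=> c x y; rewrite !reflectionE proj_linear scalerDr scalerBr !scalerA mulrC.
by rewrite opprD addrACA.
Qed.

Lemma reflectionB x y : reflection (x - y) = reflection x - reflection y.
Proof. by rewrite -scaleN1r addrC reflection_linear scaleN1r addrC. Qed.

Lemma reflection_selfadj x y : ip (reflection x) y = ip x (reflection y).
Proof. by rewrite /reflection !(ipBl ipH) !(ipBr ipH) proj_selfadj. Qed.

Lemma reflectionK x : reflection (reflection x) = x.
Proof.
have PP : P (reflection x) = P x.
  rewrite /reflection projB projB (proj_id (proj_in _)) subrr subr0 //.
rewrite [LHS]reflectionE PP reflectionE; exact: subKr.
Qed.

Lemma rnorm_reflection x : rnorm (reflection x) = rnorm x.
Proof.
have : rnorm (reflection x) ^+ 2 = rnorm x ^+ 2.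
  apply: (@complexI R); rewrite !(rnorm_sqr_ip ipH) reflection_selfadj.
  by rewrite reflectionK.
by move/eqP; rewrite eqrXn2 ?rnorm_ge0// => /eqP.
Qed.

Lemma reflection_bounded : bounded_operator reflection.
Proof.
split; first exact: reflection_linear.
apply: (rnorm_bounded_continuous (C := 1) reflection_linear) => x.
by rewrite rnorm_reflection mul1r.
Qed.

End OrthogonalProjection.

(** * Total boundedness and precompactness *)

Section TotallyBounded.
Context {R : realType} {H : completeNormedModType R[i]}.
Implicit Types (x y z : H) (s t : seq H) (A : set H).

Definition totally_bounded A : Prop := forall eps : R, 0 < eps ->
  exists t, forall x, A x -> exists2 y, y \in t & rnorm (x - y) <= eps.

Lemma ball_rnorm x (e : R) y : rnorm (x - y) < e -> ball x e%:C%C y.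
Proof. by move=> xy; rewrite -ball_normE/= rnormE ltcR. Qed.

Lemma rnorm_ball x (e : R) y : ball x e%:C%C y -> rnorm (x - y) < e.
Proof. by rewrite -ball_normE/= rnormE ltcR. Qed.

Lemma closure_rnorm A x :
  closure A x <-> forall e : R, 0 < e -> exists2 y, A y & rnorm (x - y) < e.
Proof.
split=> [Ax e e0|Ax B].
  have /Ax[y [Ay xy]] : nbhs x (ball x (e%:C%C : R[i])).
    by apply: nbhsx_ballx; rewrite ltcR.
  by exists y => //; exact: rnorm_ball.
move=> /nbhs_ballP[e /= /gtc0E[e0 eE] xB].
have [y Ay xy] := Ax _ e0; exists y; split=> //; apply: xB.
by rewrite eE; exact: ball_rnorm.
Qed.

Lemma totally_bounded_closure A : totally_bounded A -> totally_bounded (closure A).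
Proof.
move=> tA e e0; have e20 : 0 < e / 2 by rewrite divr_gt0.
have [t tP] := tA _ e20; exists t => x /closure_rnorm/(_ _ e20)[y Ay xy].
have [z zt yz] := tP y Ay; exists z => //.
rewrite -(subrK y x) -addrA (le_trans (rnormD _ _))// (splitr e) lerD//.
exact: ltW.
Qed.

(** An ultrafilter containing a finite union of balls contains one of them; as this holds for all
    radii it is Cauchy, and completeness gives its limit. *)
Lemma totally_bounded_precompact A : totally_bounded A -> precompact A.
Proof.
move=> /totally_bounded_closure tA; rewrite precompactE compact_ultra => U UU UA.
have cU : cauchy U.
  apply: cauchy_exP => E /gtc0E[e0 ->]; set e := complex.Re _ in e0 *.
  have e20 : 0 < e / 2 by rewrite divr_gt0.
  have [t tP] := tA _ e20; apply: contrapT => /forallNP Uball.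
  have : U (~` [set x | exists2 y, y \in t & rnorm (x - y) <= e / 2]).
    elim: t {tP} => [|z t IH]; first by apply: filterS filterT => x _ [].
    have Uz : U (~` ball z (e%:C%C : R[i])).
      by case: (in_ultra_setVsetC (ball z (e%:C%C : R[i])) UU) => // /Uball.
    apply: filterS2 IH Uz => x xt xz [y]; rewrite inE => /orP[/eqP->|yt] xy.
      apply: xz; apply: ball_rnorm; rewrite -rnormN opprB.
      by rewrite (le_lt_trans xy)// ltr_pdivrMr// ltr_pMr// ltr1n.
    by apply: xt; exists y.
  move=> Ut; have : U set0 by apply: filterS2 Ut UA => x xt /tP.
  exact: filter_not_empty.
have Up : U --> lim U := @cauchy_cvg H U _ cU.
exists (lim U); split; last exact: Up.
apply: (@closed_closure _ A) => B /Up UB; exact: filter_ex (filterI UA UB).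
Qed.

Lemma real_grid (eps : R) : 0 < eps -> exists g : seq R, forall a, `|a| <= 1 ->
  exists2 b, b \in g & `|a - b| <= eps.
Proof.
move=> eps0; pose k := (Num.trunc eps^-1).+1.
have k0 : 0 < k%:R :> R by rewrite ltr0n.
have keps : k%:R^-1 <= eps.
  rewrite invf_ple ?posrE//.
  have /truncn_itv/andP[_ /ltW] : 0 <= eps^-1 by rewrite invr_ge0 ltW.
  by [].
exists [seq j%:R / k%:R - 1 | j <- iota 0 (2 * k).+1] => a.
rewrite ler_norml => /andP[a1 a2].
have ak0 : 0 <= (a + 1) * k%:R by rewrite mulr_ge0 ?(ltW k0)// -lerBlDr sub0r.
have /andP[j1 j2] := truncn_itv ak0; set j := Num.trunc _ in j1 j2.
exists (j%:R / k%:R - 1).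
  apply/mapP; exists j => //; rewrite mem_iota leq0n add0n ltnS -(ler_nat R) (le_trans j1)//.
  by rewrite natrM ler_wpM2r// ?(ltW k0)//; lra.
rewrite opprB addrA (le_trans _ keps)//.
have -> : a + 1 - j%:R / k%:R = ((a + 1) * k%:R - j%:R) / k%:R.
  by field; rewrite gt_eqF.
rewrite normrM [X in _ * X]ger0_norm ?invr_ge0 ?(ltW k0)// ler_piMl ?invr_ge0 ?(ltW k0)//.
rewrite ger0_norm ?subr_ge0// lerBlDl; move: j2; rewrite -natr1; exact: ltW.
Qed.

Lemma complex_grid (eps : R) : 0 < eps -> exists g : seq R[i],
  forall c, rnorm c <= 1 -> exists2 b, b \in g & rnorm (c - b) <= eps.
Proof.
move=> eps0; have [g gP] := real_grid (divr_gt0 eps0 (ltr0n _ 2)).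
exists [seq Complex a b | a <- g, b <- g] => c c1.
have [a ag ac] := gP _ (le_trans (normr_Re_le c) c1).
have [b bg bc] := gP _ (le_trans (normr_Im_le c) c1).
exists (Complex a b); first exact: allpairs_f.
rewrite (le_trans (rnorm_le_ReIm _))// Re_add Im_add Re_opp Im_opp /=.
by rewrite (splitr eps) lerD.
Qed.

(** The finite-dimensional part of the compactness argument: each coefficient is rounded to a grid
    of the unit disc, whose mesh is divided by [rnorm (f a) + 1] to allow [f a = 0]. *)
Lemma combination_grid s (f : H -> H) (eps : R) : 0 < eps -> exists t,
  forall c : H -> R[i], (forall e, e \in s -> rnorm (c e) <= 1) ->
  exists2 y, y \in t & rnorm (\sum_(e <- s) c e *: f e - y) <= eps.
Proof.
elim: s eps => [|a s IH] eps eps0.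
  exists [:: 0] => c _; exists 0; first exact: mem_head.
  by rewrite big_nil subrr rnorm0 ltW.
have eps20 : 0 < eps / 2 by rewrite divr_gt0.
have [t tP] := IH _ eps20.
have f0 : 0 < rnorm (f a) + 1 by rewrite ltr_wpDl// rnorm_ge0.
have [g gP] := complex_grid (divr_gt0 eps20 f0).
exists [seq z *: f a + y | z : R[i] <- g, y : H <- t] => c c1.
have [|y yt yP] := tP c; first by move=> e es; apply: c1; rewrite inE es orbT.
have [z zg zP] := gP _ (c1 a (mem_head _ _)).
exists (z *: f a + y); first exact: allpairs_f.
rewrite big_cons opprD addrACA (le_trans (rnormD _ _))// (splitr eps) lerD//.
rewrite -scalerBl rnormZ (@le_trans _ _ (eps / 2 / (rnorm (f a) + 1) * rnorm (f a)))//.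
  by rewrite ler_wpM2r// rnorm_ge0.
by rewrite mulrAC ler_pdivrMr// ler_wpM2l ?(ltW eps20)// lerDl.
Qed.

End TotallyBounded.

Section HilbertSchmidt.
Context {R : realType} {H : completeNormedModType R[i]} {ip : H -> H -> R[i]}.
Hypothesis ipH : inner_product ip.
Context {T : H -> H} {C : R}.
Hypothesis linT : linear T.
Hypothesis TC : hs_le (ip := ip) setT T C.
Local Notation orthonormal_seq := (orthonormal_seq (ip := ip)).

Let hs_sums : set R :=
  [set \sum_(e <- s) rnorm (T e) ^+ 2 | s in [set s | orthonormal_seq s]].

Let has_sup_hs : has_sup hs_sums.
Proof.
split; first by exists 0, [::] => //; rewrite big_nil.
by exists C => _ [s os <-]; exact: TC.
Qed.

Let linTZ c x : T (c *: x) = c *: T x.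
Proof.
have T0 : T 0 = 0.
  by apply: (addrI (T 0)); rewrite -{1}[T 0]scale1r -linT scale1r !addr0.
by rewrite -[c *: x]addr0 linT T0 addr0.
Qed.

Let linTD x y : T (x + y) = T x + T y.
Proof. by rewrite -[x]scale1r linT !scale1r. Qed.

(* An orthonormal family whose sum is nearly maximal leaves room only for a small
   norm of [T] on its orthogonal complement. *)
Lemma hs_tail (eps : R) : 0 < eps -> exists2 s, orthonormal_seq s &
  forall x, (forall e, e \in s -> ip x e = 0) -> rnorm (T x) <= eps * rnorm x.
Proof.
move=> eps0; have eps20 : 0 < eps ^+ 2 by rewrite exprn_gt0.
have [_ [s os <-] sS] := sup_adherent eps20 has_sup_hs.
exists s => // x xs; have [->|x0] := eqVneq x 0.
  by rewrite -[X in T X](scale0r (0 : H)) linTZ scale0r !rnorm0 mulr0.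
have : \sum_(e <- normalize x :: s) rnorm (T e) ^+ 2 <= sup hs_sums.
  apply: ub_le_sup; first by case: has_sup_hs.
  exists (normalize x :: s) => //=; split=> // [|e es]; first exact: ip_normalize.
  by rewrite (ipZl ipH) xs// mulr0.
rewrite big_cons; set S := \sum_(_ <- _) _ in sS *; set m := sup _ in sS *.
move=> Sm; have {sS Sm} : rnorm (T (normalize x)) ^+ 2 <= eps ^+ 2 by lra.
rewrite ler_sqr ?nnegrE ?rnorm_ge0 ?(ltW eps0)// => Tx.
rewrite -{1}(normalizeK x) linTZ rnormZ rnorm_real ger0_norm ?rnorm_ge0// mulrC.
by rewrite ler_wpM2r// rnorm_ge0.
Qed.

(** A unit vector splits into its projection on a finite family, with coefficients at most 1 by
    Bessel, and an orthogonal remainder on which [T] is small by [hs_tail]. *)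
Lemma hs_totally_bounded : totally_bounded (T @` [set x | `|x| <= 1]).
Proof.
move=> eps eps0; have eps20 : 0 < eps / 2 by rewrite divr_gt0.
have [s os sT] := hs_tail eps20.
have [t tP] := combination_grid s T eps20; exists t => _ [x /= x1 <-].
have {}x1 : rnorm x <= 1 by rewrite -lecR -rnormE.
have xsq : rnorm x ^+ 2 <= 1 by rewrite expr_le1// rnorm_ge0.
have [e es|y yt yP] := tP (ip x).
  rewrite -(@expr_le1 _ 2)// ?rnorm_ge0// (le_trans _ xsq)//.
  rewrite (le_trans _ (bessel ipH x os))// (big_rem e)//= lerDl.
  by rewrite sumr_ge0// => f _; rewrite sqr_ge0.
exists y => //.
have Tproj : T (seq_proj (ip := ip) s x) = \sum_(e <- s) ip x e *: T e.
  rewrite /seq_proj; elim: (s) => [|e s' IH]; last by rewrite !big_cons linT IH.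
  by rewrite !big_nil -[X in T X](scale0r (0 : H)) linTZ scale0r.
rewrite -(subrK (seq_proj (ip := ip) s x) x) linTD Tproj -addrA.
rewrite (le_trans (rnormD _ _))// (splitr eps) lerD//.
rewrite (le_trans (sT _ _))//; first by move=> e es; exact: (ip_sub_seq_proj ipH).
rewrite ler_piMr ?(ltW eps20)// -(@expr_le1 _ 2)// ?rnorm_ge0// (le_trans _ xsq)//.
by rewrite (rnorm_sqr_seq_proj ipH x os) lerDl sumr_ge0// => e _; rewrite sqr_ge0.
Qed.

(** By Zorn's lemma: a nonzero vector orthogonal to a maximal orthonormal set could be normalized
    and added to it. *)
Lemma exists_orthonormal_basis : exists B, orthonormal_basis ip B.
Proof.
pose P (B : set H) := (forall e, B e -> `|e| = 1) /\
  (forall e f, B e -> B f -> e != f -> ip e f = 0).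
have [G GP Gtot|B [[B1 BB] Bmax]] := @Zorn_bigcup H P.
  split=> [e [X /GP[X1 _] Xe]|e f [X GX Xe] [Y GY Yf]]; first exact: X1.
  have [XY|YX] := Gtot X Y GX GY.
    by case: (GP Y GY) => _; apply => //; exact: XY.
  by case: (GP X GX) => _; apply => //; exact: YX.
exists B; split=> // x xB; apply: contrapT => /eqP x0.
have nx1 : `|normalize x| = 1.
  apply/eqP; rewrite -(@pexpr_eq1 _ _ 2)//.
  by rewrite (ip_norm ipH) (ip_normalize ipH).
have nxB e : B e -> ip (normalize x) e = 0.
  by move=> Be; rewrite (ipZl ipH) xB// mulr0.
apply: (Bmax (B `|` [set normalize x])); last first.
  split=> [e [/B1//|->//]|e f [Be|->] [Bf|->]]; last by rewrite eqxx.
  - exact: BB.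
  - by move=> _; apply: (ip_eq0C ipH); exact: nxB.
  - by move=> _; exact: nxB.
split; first by move=> e Be; left.
move=> /(_ (normalize x)) nB; have /nxB : B (normalize x) by apply: nB; right.
by rewrite (ip_normalize ipH) => // /eqP; rewrite oner_eq0.
Qed.

(** The sum over a basis is a supremum over its finite subsets, each of which is enumerated by an
    orthonormal sequence. *)
Lemma hs_le_hilbert_schmidt : continuous T -> hilbert_schmidt ip T.
Proof.
move=> cT; split; first by split.
have [B oB] := exists_orthonormal_basis; have [B1 BB _] := oB.
exists B => //; apply: (@le_lt_trans _ _ C%:E); last exact: ltry.
apply: ge_ereal_sup => _ [A [Afin AB] <-].
rewrite fsbig_finite//= sumEFin lee_fin; apply: TC => //.
have : forall e, e \in finmap.enum_fset (fset_set A) -> B e.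
  by move=> e; rewrite in_fset_set// inE => /AB.
have := finmap.fset_uniq (fset_set A).
elim: (finmap.enum_fset _) => [//|e s IH] /= /andP[es us] sB; split.
- by rewrite -(ip_norm ipH) B1 ?expr1n//; apply: sB; exact: mem_head.
- move=> f fs; apply: BB.
  + by apply: sB; exact: mem_head.
  + by apply: sB; rewrite inE fs orbT.
  + by apply: contraNneq es => ->.
- by apply: IH => // f fs; apply: sB; rewrite inE fs orbT.
Qed.

End HilbertSchmidt.

(** * Commutators with the representation *)

Section StarRepresentation.
Context {R : realType} {K : topologicalType} {H : completeNormedModType R[i]}.
Context {ip : H -> H -> R[i]} {rho : (K -> R[i]) -> H -> H}.
Hypothesis ipH : inner_product ip.
Hypothesis rhoH : star_representation ip rho.
Implicit Types (x y : H) (a b : K -> R[i]) (f g : K -> R).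

(** The integral of [f] against the spectral measure of [x]. *)
Let phi x f := ip x (rho (fun t => (f t)%:C%C) x).

Let phi_lin x (c : R) f g : continuous f -> continuous g ->
  phi x (fun t => c * f t + g t) = c%:C%C * phi x f + phi x g.
Proof.
move=> cf cg; rewrite /phi; under eq_fun do rewrite rmorphD rmorphM/=.
rewrite (rep_linear rhoH) ?(ipDr ipH) ?(ipZr ipH); last 2 first.
- exact: continuousC_real.
- exact: continuousC_real.
by congr (_ * _ + _); exact: conjc_real.
Qed.

Lemma rnorm_sqr_rep a x : continuousC a ->
  (rnorm (rho a x) ^+ 2)%:C%C = phi x (fun t => rnorm (a t) ^+ 2).
Proof.
move=> ca; rewrite (rnorm_sqr_ip ipH) (rep_star rhoH)//.
rewrite -(rep_mul rhoH x (continuousC_conj ca) ca).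
by congr (ip x (rho _ x)); apply/funext => t; rewrite mulrC mul_conjE.
Qed.

Let cst_continuous (c : R) : continuous (fun _ : K => c).
Proof. by move=> t; exact: cvg_cst. Qed.

Let phi0 x : phi x (fun=> 0) = 0.
Proof.
have := @phi_lin x 1 _ _ (@cst_continuous 0) (@cst_continuous 0).
under eq_fun do rewrite mulr0 addr0.
by rewrite mul1r => /eqP; rewrite -subr_eq subrr eq_sym => /eqP.
Qed.

Let rep1 x : phi x (fun=> 1) = (rnorm (rho (fun=> 1) x) ^+ 2)%:C%C.
Proof.
rewrite rnorm_sqr_rep; last exact: continuousC_cst.
by congr (phi x _); apply/funext => t; rewrite rnorm_real normr1 expr1n.
Qed.

(** [rho] of the constant 1 is a self-adjoint idempotent, possibly not the identity; [x] minus its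
    image is orthogonal to that image. *)
Let rep1_le x : rnorm (rho (fun=> 1) x) ^+ 2 <= rnorm x ^+ 2.
Proof.
rewrite -[in leRHS](subrK (rho (fun=> 1) x) x) (rnorm_sqrD_orth ipH).
  by rewrite lerDr sqr_ge0.
rewrite (ipBl ipH) -(rnorm_sqr_ip ipH) -rep1; exact: subrr.
Qed.

(* [C - sum_i |b_i|^2] is a square [|h|^2], hence acts as a nonnegative operator. *)
Lemma rep_sum_sqr_le (I : eqType) (s : seq I) (b : I -> K -> R[i]) (C : R) x :
  0 <= C -> (forall i, continuousC (b i)) ->
  (forall t, \sum_(i <- s) rnorm (b i t) ^+ 2 <= C) ->
  \sum_(i <- s) rnorm (rho (b i) x) ^+ 2 <= C * rnorm x ^+ 2.
Proof.
move=> C0 cb bC; pose q s t := \sum_(i <- s) rnorm (b i t) ^+ 2.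
have cq u : continuous (q u).
  move=> t; apply: (continuous_big (op := +%R)) => [|i _].
    exact: add_continuous.
  exact: continuous_rnorm_sqr.
have sumE u : phi x (q u) = (\sum_(i <- u) rnorm (rho (b i) x) ^+ 2)%:C%C.
  elim: u => [|i u IH].
    rewrite /q; under eq_fun do rewrite big_nil; rewrite big_nil.
    exact: phi0.
  rewrite big_cons rmorphD/= -IH rnorm_sqr_rep// -[X in X + _]mul1r.
  rewrite -(phi_lin x 1) //; last exact: continuous_rnorm_sqr.
  by congr (phi x _); apply/funext => t; rewrite /q big_cons mul1r.
pose h t : R[i] := (Num.sqrt (C - q s t))%:C%C.
have ch : continuousC h.
  apply: continuousC_real => t; apply: continuous_comp; last exact: sqrt_continuous.
  by apply: cvgB; [exact: cvg_cst|exact: cq].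
have : (rnorm (rho h x) ^+ 2)%:C%C =
    (C * rnorm (rho (fun=> 1) x) ^+ 2 - \sum_(i <- s) rnorm (rho (b i) x) ^+ 2)%:C%C.
  rewrite rnorm_sqr_rep// rmorphB rmorphM/= -rep1 -sumE.
  have -> : (fun t => rnorm (h t) ^+ 2) = (fun t => C * 1 + (-1 * q s t + 0)).
    apply/funext => t; rewrite rnorm_real real_normK ?num_real// sqr_sqrtr.
      by rewrite mulr1 addr0 mulN1r.
    by rewrite subr_ge0; exact: bC.
  rewrite phi_lin//; last first.
    by move=> t; apply: cvgD; [apply: cvgM; [exact: cvg_cst|exact: cq]|exact: cvg_cst].
  by rewrite phi_lin// phi0 addr0 rmorphN rmorph1 mulN1r.
move=> /(@complexI R) hE.
have := sqr_ge0 (rnorm (rho h x)); rewrite hE subr_ge0 => /le_trans; apply.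
by rewrite ler_wpM2l// rep1_le.
Qed.

Lemma rep_norm_le a (A : R) x : 0 <= A -> continuousC a ->
  (forall t, rnorm (a t) <= A) -> rnorm (rho a x) <= A * rnorm x.
Proof.
move=> A0 ca aA; rewrite -ler_sqr ?nnegrE ?rnorm_ge0 ?mulr_ge0 ?rnorm_ge0//.
have := @rep_sum_sqr_le unit [:: tt] (fun=> a) (A ^+ 2) x (sqr_ge0 A) (fun=> ca).
rewrite big_seq1 exprMn; apply => t.
by rewrite big_seq1 lerXn2r ?nnegrE ?rnorm_ge0.
Qed.

Lemma repB a b x : continuousC a -> continuousC b ->
  rho (fun t => a t - b t) x = rho a x - rho b x.
Proof.
move=> ca cb; have := rep_linear rhoH (-1) x cb ca.
by under eq_fun do rewrite mulN1r addrC; move=> ->; rewrite scaleN1r addrC.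
Qed.

Lemma rep_linear_op a : continuousC a -> linear (rho a).
Proof. by move=> /(rep_bounded rhoH)[]. Qed.

Lemma rep_vecB a x y : continuousC a -> rho a (x - y) = rho a x - rho a y.
Proof.
by move=> /rep_linear_op la; rewrite -scaleN1r addrC la scaleN1r addrC.
Qed.

Lemma rep_vecD a x y : continuousC a -> rho a (x + y) = rho a x + rho a y.
Proof. by move=> /rep_linear_op la; rewrite -[x]scale1r la !scale1r. Qed.

End StarRepresentation.

Lemma rnorm_sqr_comb (R : realType) (H : completeNormedModType R[i])
    (ip : H -> H -> R[i]) (ipH : inner_product ip) (s : seq H) (c : H -> R[i]) :
  orthonormal_seq (ip := ip) s ->
  rnorm (\sum_(e <- s) c e *: e) ^+ 2 = \sum_(e <- s) rnorm (c e) ^+ 2.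
Proof.
elim: s => [|a s IH]; first by rewrite !big_nil rnorm0 expr0n.
move=> [a1 as0 os]; rewrite !big_cons (rnorm_sqrD_orth ipH) ?IH//; last first.
  rewrite (ip_sumr ipH) big1_seq// => e /andP[_ es].
  by rewrite (ipZl ipH) (ipZr ipH) as0// !mulr0.
congr (_ + _); rewrite rnormZ exprMn.
suff -> : rnorm a ^+ 2 = 1 by rewrite mulr1.
by apply: (@complexI R); rewrite (rnorm_sqr_ip ipH) a1.
Qed.

Lemma closure_linear_subspace (R : realType) (H : completeNormedModType R[i]) (A : set H) :
  linear_subspace A -> linear_subspace (closure A).
Proof.
move=> [A0 AD]; split; first exact: subset_closure.
move=> c x y /closure_rnorm Ax /closure_rnorm Ay; apply/closure_rnorm => e e0.
have c0 : 0 < rnorm c + 1 by rewrite ltr_wpDl// rnorm_ge0.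
have e20 : 0 < e / 2 by rewrite divr_gt0.
have [x' Ax' xx'] := Ax _ (divr_gt0 e20 c0); have [y' Ay' yy'] := Ay _ e20.
exists (c *: x' + y'); first exact: AD.
rewrite opprD addrACA -scalerBr (le_lt_trans (rnormD _ _))// (splitr e) ltr_leD//.
  rewrite rnormZ (@le_lt_trans _ _ (rnorm c * (e / 2 / (rnorm c + 1))))//.
    by rewrite ler_wpM2l ?rnorm_ge0// ltW.
  by rewrite mulrA ltr_pdivrMr// mulrC ltr_pM2l// ltrDl.
exact: ltW.
Qed.

(** * Commutator estimates from abstract properties of the form domain *)

Section CompactCommutators.
Context {R : realType} {K : topologicalType} {H : completeNormedModType R[i]}.
Context {ip : H -> H -> R[i]} {rho : (K -> R[i]) -> H -> H} {P : H -> H}.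
Context {dom : set (K -> R[i])} {en : (K -> R[i]) -> R} {J : H -> H}.
Context {d : (K -> R[i]) -> H}.
Hypothesis ipH : inner_product ip.
Hypothesis rhoH : star_representation ip rho.
Hypothesis derd : derivation rho dom en J d.
Let M := closure (d @` dom).
Hypothesis PM : orthogonal_projection ip P M.

Hypothesis boundedC : forall a : K -> R[i], continuousC a ->
  exists2 A, 0 <= A & forall t, rnorm (a t) <= A.
Hypothesis dom_continuous : forall a, dom a -> continuousC a.
Hypothesis dom0 : dom (fun=> 0).
Hypothesis dom_comb : forall c a b, dom a -> dom b -> dom (fun t => c * a t + b t).
Hypothesis domM : forall a b, dom a -> dom b -> dom (fun t => a t * b t).
Hypothesis dom_conj : forall a, dom a -> dom (fun t => (a t)^*).
Hypothesis dom_dense : forall a (eps : R), continuousC a -> 0 < eps ->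
  exists2 b, dom b & forall t, rnorm (a t - b t) <= eps.
Hypothesis dom_representatives : exists2 G, 0 <= G &
  forall (I : eqType) (s : seq I) (b : I -> K -> R[i]) (eps : R),
  (forall i, dom (b i)) -> 0 < eps ->
  exists b' : I -> K -> R[i],
  [/\ forall i, dom (b' i),
      forall i, en (fun t => b' i t - b i t) = 0 &
      forall (c : I -> R[i]) t, rnorm (\sum_(i <- s) c i * b' i t) <=
        G * Num.sqrt (en (fun t => \sum_(i <- s) c i * b i t)) +
        eps * \sum_(i <- s) rnorm (c i)].

Lemma der0 : d (fun=> 0) = 0.
Proof.
have := der_linear derd 1 dom0 dom0; under eq_fun do rewrite mulr0 addr0.
by rewrite scale1r => /eqP; rewrite -subr_eq subrr eq_sym => /eqP.
Qed.

Lemma der_sum (I : eqType) (s : seq I) (c : I -> R[i]) (b : I -> K -> R[i]) :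
  (forall i, dom (b i)) ->
  dom (fun t => \sum_(i <- s) c i * b i t) /\
  d (fun t => \sum_(i <- s) c i * b i t) = \sum_(i <- s) c i *: d (b i).
Proof.
move=> domb; elim: s => [|i s [IH1 IH2]].
  by under eq_fun do rewrite big_nil; rewrite big_nil der0.
under eq_fun do rewrite big_cons; rewrite big_cons.
by split; [exact: dom_comb|rewrite (der_linear derd)// IH2].
Qed.

Lemma rnorm_der a : dom a -> rnorm (d a) = Num.sqrt (en a).
Proof.
move=> doma; rewrite -[LHS]ger0_norm ?rnorm_ge0// -sqrtr_sqr; congr Num.sqrt.
by apply: (@complexI R); rewrite -(der_energy derd)// rnormE rmorphXn.
Qed.

(** This is what permits replacing functions by their corrected representatives. *)
Lemma der_eq a b : dom a -> dom b -> en (fun t => a t - b t) = 0 -> d a = d b.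
Proof.
move=> doma domb ab; apply/eqP; rewrite -subr_eq0; apply/eqP/rnorm_eq0.
have -> : d a - d b = d (fun t => -1 * b t + a t).
  by rewrite (der_linear derd)// scaleN1r addrC.
rewrite rnorm_der; last exact: dom_comb.
by under eq_fun do rewrite mulN1r addrC; rewrite ab sqrtr0.
Qed.

Let sM : linear_subspace M.
Proof.
apply: closure_linear_subspace; split; first by exists (fun=> 0) => //; exact: der0.
move=> c _ _ [a doma <-] [b domb <-]; exists (fun t => c * a t + b t).
  exact: dom_comb.
exact: (der_linear derd).
Qed.

Let derM a : dom a -> M (d a).
Proof. by move=> doma; apply: subset_closure; exists a. Qed.

Let Pc x := x - P x.

Let PcD x y : Pc (x + y) = Pc x + Pc y.
Proof. by rewrite /Pc (projD ipH sM PM) opprD addrACA. Qed.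

Let PcM x : M x -> Pc x = 0.
Proof. by move=> Mx; rewrite /Pc (proj_id ipH sM PM Mx) subrr. Qed.

Let Pc_le x : rnorm (Pc x) <= rnorm x.
Proof.
rewrite -ler_sqr ?nnegrE ?rnorm_ge0// [leRHS](proj_pythagoras ipH PM x).
by rewrite lerDr sqr_ge0.
Qed.

Let Pc_selfadj x y : ip (Pc x) y = ip x (Pc y).
Proof. by rewrite /Pc (ipBl ipH) (ipBr ipH) (proj_selfadj ipH PM). Qed.

(* Leibniz' rule, since [a b] lies in the domain. *)
Let Pc_leibniz a b : dom a -> dom b ->
  rnorm (Pc (rho a (d b))) <= rnorm (rho b (d a)).
Proof.
move=> doma domb; have := derM (domM doma domb).
rewrite (der_leibniz derd)// => /PcM; rewrite PcD => /eqP.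
rewrite addrC addr_eq0 => /eqP ->; rewrite rnormN; exact: Pc_le.
Qed.

(* Duality: for fixed [t], the coefficients [c e = conj (b' e t)] turn
   [sum |b' e t|^2] into the value at [t] of a function of controlled energy. *)
Lemma representatives_sum_sqr_le (G eps : R) s (b b' : H -> K -> R[i]) t :
  0 <= G -> 0 < eps -> eps *+ size s <= 1 ->
  orthonormal_seq (ip := ip) s -> (forall e, dom (b e)) ->
  (forall e, e \in s -> rnorm (e - d (b e)) <= eps) ->
  (forall (c : H -> R[i]) t, rnorm (\sum_(e <- s) c e * b' e t) <=
        G * Num.sqrt (en (fun t => \sum_(e <- s) c e * b e t)) +
        eps * \sum_(e <- s) rnorm (c e)) ->
  \sum_(e <- s) rnorm (b' e t) ^+ 2 <= (G + G + 1) ^+ 2.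
Proof.
move=> G0 eps0 epss os domb bs bb'.
set S := \sum_(e <- s) _; have S0 : 0 <= S by apply: sumr_ge0 => e _; exact: sqr_ge0.
pose q := Num.sqrt S; have q0 : 0 <= q := sqrtr_ge0 S.
have qS : q ^+ 2 = S by rewrite sqr_sqrtr.
pose c e := (b' e t)^*.
(* Each coefficient is at most [q], and [eps] times the length of the family is at most 1. *)
have w_le : eps * \sum_(e <- s) rnorm (c e) <= q.
  rewrite (@le_trans _ _ (eps * (q *+ size s)))//; last first.
    by rewrite mulrnAr -mulrnAl ler_piMl.
  rewrite ler_wpM2l ?(ltW eps0)//.
  have -> : q *+ size s = \sum_(e <- s) q.
    by rewrite big_const_seq iter_addr addr0 count_predT.
  rewrite big_seq [leRHS]big_seq ler_sum// => e es.
  rewrite -ler_sqr ?nnegrE ?rnorm_ge0// qS rnorm_conj /S (big_rem e)//= lerDl.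
  by rewrite sumr_ge0// => f _; rewrite sqr_ge0.
have [domB dB] := der_sum s c domb.
(* The combination of the vectors [e] has norm at most [q] by orthonormality, and replacing [e] by
   [d (b e)] costs at most [q] more; the last [q] is the error term of the representatives. Dividing
   q^2 <= (2 G + 1) q by [q] gives the bound. *)
have Sle : S <= G * (q + q) + q.
  have := bb' c t; rewrite -rnorm_der// dB.
  have -> : \sum_(e <- s) c e * b' e t = S%:C%C.
    rewrite rmorph_sum/=; apply: eq_bigr => e _.
    by rewrite mulrC mul_conjE.
  rewrite rnorm_real ger0_norm// => /le_trans; apply; apply: lerD => //.
  rewrite ler_wpM2l//.
  have -> : \sum_(e <- s) c e *: d (b e) =
      \sum_(e <- s) c e *: e - \sum_(e <- s) c e *: (e - d (b e)).
    rewrite -sumrB; apply: eq_bigr => e _.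
    by rewrite -scalerBr subKr.
  rewrite (le_trans (rnormB _ _))// lerD//.
    rewrite -ler_sqr ?nnegrE ?rnorm_ge0// (rnorm_sqr_comb ipH)// qS /S.
    by apply: ler_sum => e _; rewrite rnorm_conj.
  rewrite (le_trans _ w_le)// (le_trans (ler_rnorm_sum _ _))// mulr_sumr.
  rewrite big_seq [leRHS]big_seq ler_sum// => e es.
  by rewrite rnormZ mulrC ler_wpM2r ?rnorm_ge0// bs.
rewrite -qS lerXn2r ?nnegrE ?addr_ge0//.
have [->|qn0] := eqVneq q 0; first by rewrite !addr_ge0.
have q1 : 0 < q by rewrite lt_neqAle eq_sym qn0.
rewrite -(ler_pM2l q1) -expr2 qS (le_trans Sle)// le_eqVlt; apply/orP; left.
by apply/eqP; ring.
Qed.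

Lemma compression_hs_le a : dom a -> exists C : R,
  hs_le (ip := ip) M (fun x => Pc (rho a x)) C.
Proof.
move=> doma; have ca := dom_continuous doma.
have [G G0 reps] := dom_representatives; have [A A0 aA] := boundedC ca.
pose C := (G + G + 1) ^+ 2 * rnorm (d a) ^+ 2.
exists (2 * C + 2 * A ^+ 2) => s os Ms.
(* The precision depends on the length of the family, which keeps the total error bounded by a
   constant independent of it. *)
pose eps : R := (size s).+1%:R^-1.
have eps0 : 0 < eps by rewrite invr_gt0 ltr0n.
have epss : eps *+ size s <= 1.
  by rewrite -mulr_natr mulrC ler_pdivrMr ?ltr0n// mul1r ler_nat.
have eps1 : eps <= 1 by rewrite invf_le1 ?ltr0n// ler1n.
have /choice[b bP] : forall e, exists b, dom b /\ (M e -> rnorm (e - d b) <= eps).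
  move=> e; have [Me|nMe] := pselect (M e); last by exists (fun=> 0).
  have [_ [b domb <-] eb] := (closure_rnorm _ _).1 Me _ eps0.
  by exists b; split=> // _; exact: ltW.
have domb e : dom (b e) by case: (bP e).
have eb e : e \in s -> rnorm (e - d (b e)) <= eps.
  by move=> /Ms Me; case: (bP e) => _; apply.
have [b' [domb' b'b bb']] := reps H s b eps domb eps0.
have db' e : d (b' e) = d (b e) by apply: der_eq.
have b'S t : \sum_(e <- s) rnorm (b' e t) ^+ 2 <= (G + G + 1) ^+ 2.
  exact: (representatives_sum_sqr_le (b := b) t G0 eps0 epss).
have sumC : \sum_(e <- s) rnorm (rho (b' e) (d a)) ^+ 2 <= C.
  have cb' e := dom_continuous (domb' e).
  exact: (rep_sum_sqr_le ipH rhoH (d a) (sqr_ge0 (G + G + 1)) cb' b'S).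
(* Leibniz' rule applies to [d (b e) = d (b' e)]; the remainder has norm at most [eps], and eps^2 <=
   eps, so these errors sum to at most 2 A^2. *)
have step e : e \in s -> rnorm (Pc (rho a e)) ^+ 2 <=
    2 * rnorm (rho (b' e) (d a)) ^+ 2 + 2 * (A ^+ 2 * eps).
  move=> es; rewrite -[e in leLHS](subrK (d (b e))) addrC (rep_vecD rhoH)// PcD.
  rewrite (le_trans (rnorm_sqrD_le _ _))// lerD// ler_wpM2l//.
    by rewrite lerXn2r ?nnegrE ?rnorm_ge0// -db'; exact: Pc_leibniz.
  rewrite (@le_trans _ _ ((A * eps) ^+ 2))//.
    rewrite lerXn2r ?nnegrE ?rnorm_ge0 ?mulr_ge0// ?(ltW eps0)//.
    rewrite (le_trans (Pc_le _))// (le_trans (rep_norm_le ipH rhoH _ A0 ca aA))//.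
    by rewrite ler_wpM2l// eb.
  by rewrite exprMn ler_wpM2l ?sqr_ge0// expr2 ler_piMl// ltW.
rewrite big_seq (le_trans (ler_sum _ step))// -big_seq big_split/= -!mulr_sumr.
rewrite lerD// ler_wpM2l//.
rewrite big_const_seq iter_addr addr0 count_predT.
by rewrite ler_piMr ?sqr_ge0.
Qed.

Let setTsub : linear_subspace [set: H]. Proof. by []. Qed.

Lemma off_diagonal_hs_le a : dom a -> exists C : R,
  hs_le (ip := ip) setT (fun x => P (rho a (Pc x))) C.
Proof.
move=> doma; have [C TC] := compression_hs_le (dom_conj doma); exists C.
apply: (hs_le_adjoint ipH sM _ _ TC) => [x|x y My]; first exact: (proj_in PM).
rewrite (proj_selfadj ipH PM) (proj_id ipH sM PM My).
by rewrite (rep_star rhoH) ?Pc_selfadj//; exact: dom_continuous.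
Qed.

Lemma commutator_hs_le a : dom a -> exists C : R,
  hs_le (ip := ip) setT (commutator (reflection (P := P)) (rho a)) C.
Proof.
move=> doma; have ca := dom_continuous doma.
have [C1 S1] := off_diagonal_hs_le doma.
have [C2 S2] := off_diagonal_hs_le (dom_conj doma).
(* A second adjoint is taken because [compression_hs_le] bounds this operator only along families of
   [M], while the commutator needs all families. *)
have S3 : hs_le (ip := ip) setT (fun x => Pc (rho a (P x))) C2.
  apply: (hs_le_adjoint ipH setTsub _ _ S2) => // x y _.
  rewrite Pc_selfadj (rep_star rhoH)//.
  by rewrite (proj_selfadj ipH PM).
exists (2 * 2 ^+ 2 * (C1 + C2)).
have -> : commutator (reflection (P := P)) (rho a) =
    (fun x => (2%:R : R)%:C%C *: (P (rho a (Pc x)) - Pc (rho a (P x)))).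
  apply/funext => x; rewrite /commutator !reflectionE (rep_vecB rhoH)//.
  have la := rep_linear_op rhoH ca.
  have -> : rho a (2 *: P x) = 2 *: rho a (P x).
    by rewrite !scaler_nat !mulr2n (rep_vecD rhoH).
  rewrite rmorph_nat /Pc (rep_vecB rhoH)// (projB ipH sM PM).
  by rewrite !opprB !addrA !subrK -scalerBr.
exact: (hs_le_comb _ S1 S3).
Qed.

Lemma commutator_linear a : continuousC a ->
  linear (commutator (reflection (P := P)) (rho a)).
Proof.
move=> ca c x y; rewrite /commutator (reflection_linear ipH sM PM).
have la := rep_linear_op rhoH ca.
by rewrite !la (reflection_linear ipH sM PM) opprD addrACA -scalerBr.
Qed.

Lemma commutator_norm_le a (A : R) x : 0 <= A -> continuousC a ->
  (forall t, rnorm (a t) <= A) ->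
  rnorm (commutator (reflection (P := P)) (rho a) x) <= 2 * A * rnorm x.
Proof.
move=> A0 ca aA; rewrite (le_trans (rnormB _ _))// -mulrA mulrDl mul1r lerD//.
  by rewrite (rnorm_reflection ipH sM PM) (rep_norm_le ipH rhoH _ A0 ca aA).
rewrite (le_trans (rep_norm_le ipH rhoH _ A0 ca aA))//.
by rewrite (rnorm_reflection ipH sM PM).
Qed.

Lemma commutator_continuous a : continuousC a ->
  continuous (commutator (reflection (P := P)) (rho a)).
Proof.
move=> ca; have [A A0 aA] := boundedC ca.
apply: (rnorm_bounded_continuous (C := 2 * A)); first exact: commutator_linear.
by move=> x; exact: commutator_norm_le.
Qed.

Lemma commutator_compact a : continuousC a ->
  compact_operator (commutator (reflection (P := P)) (rho a)).
Proof.
move=> ca; split; first by split; [exact: commutator_linear|exact: commutator_continuous].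
apply: totally_bounded_precompact => eps eps0.
(* The commutator with a function of sup norm at most eps / 4 has norm at most eps / 2. *)
have eps40 : 0 < eps / 4 by rewrite divr_gt0.
have eps20 : 0 < eps / 2 by rewrite divr_gt0.
have [b domb ab] := dom_dense ca eps40; have cb := dom_continuous domb.
have [C bC] := commutator_hs_le domb.
have [t tP] := hs_totally_bounded ipH (commutator_linear cb) bC eps20.
exists t => _ [x x1 <-].
have [|y yt yP] := tP (commutator (reflection (P := P)) (rho b) x); first by exists x.
exists y => //; set Ta := commutator _ _ x; set Tb := commutator _ _ x in yP.
rewrite -(subrK Tb Ta) -addrA (le_trans (rnormD _ _))// (splitr eps) lerD//.
have -> : Ta - Tb = commutator (reflection (P := P)) (rho (fun t => a t - b t)) x.
  rewrite /Ta /Tb /commutator !(repB rhoH)// (reflectionB ipH sM PM).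
  by rewrite !opprB addrACA [RHS]addrACA [X in _ + X = _]addrC.
have cab : continuousC (fun t => a t - b t).
  have := continuousC_comb (c := -1) cb ca.
  by under eq_fun do rewrite mulN1r addrC.
rewrite (le_trans (commutator_norm_le _ (ltW eps40) cab ab))//.
have -> : eps / 2 = 2 * (eps / 4) * 1 by field.
apply: ler_wpM2l; first by rewrite mulr_ge0// ltW.
by rewrite -lecR -rnormE.
Qed.

Lemma commutator_hilbert_schmidt a : dom a ->
  hilbert_schmidt ip (commutator (reflection (P := P)) (rho a)).
Proof.
move=> doma; have ca := dom_continuous doma; have [C aC] := commutator_hs_le doma.
apply: (hs_le_hilbert_schmidt ipH (commutator_linear ca) aC).
exact: commutator_continuous.
Qed.

End CompactCommutators.

Lemma continuousC_bounded (R : realType) (K : metricType R) (N : nat)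
    (F : 'I_N -> K -> K) (coding : code_space N -> K) (a : K -> R[i]) :
  self_similar_structure F coding -> continuousC a ->
  exists2 A, 0 <= A & forall t, rnorm (a t) <= A.
Proof.
move=> sss /continuousCP[cr ci].
have [A A0 aA] := continuous_bounded sss cr.
have [B B0 aB] := continuous_bounded sss ci.
exists (A + B) => [|t]; first exact: addr_ge0.
by rewrite (le_trans (rnorm_le_ReIm _))// lerD.
Qed.

Theorem theorem3p3 (R : realType) (K : metricType R) (N : nat)
    (F : 'I_N -> K -> K) (pi : code_space N -> K)
    (n : nat) (v : 'I_n -> K) (D : 'M[R]_n) (r : 'I_N -> R)
    (H : completeNormedModType R[i]) (ip : H -> H -> R[i])
    (rho : (K -> R[i]) -> H -> H) (J : H -> H)
    (d : (K -> R[i]) -> H) (P : H -> H) :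
  self_similar_structure F pi ->
  pcf F pi ->
  enumerates v (V0 F pi) ->
  regular_harmonic_structure F pi v D r ->
  inner_product ip ->
  star_representation ip rho ->
  conjugation rho J ->
  derivation rho (form_domain F v D r) (energy F v D r) J d ->
  orthogonal_projection ip P (closure (d @` form_domain F v D r)) ->
  let Phi : H -> H := fun x => P x - (x - P x) in
  fredholm_module ip rho Phi /\ densely_2_summable ip rho Phi.
Proof.
move=> sss _ venum rhs ipH rhoH _ derd PM Phi.
have boundedC a := @continuousC_bounded R K N F pi a sss.
have domC := @form_domain_continuous R K N F n v D r.
have dom0 := form_domain0 rhs.
have dom_comb := @form_domain_comb R K N F pi n v D r rhs.
have dom_conj := @form_domain_conj R K N F pi n v D r rhs.
have domM := @form_domainM R K N F pi n v D r sss rhs.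
have dense := @form_domain_dense R K N F pi n v D r sss venum rhs.
have reps := uniform_representatives sss venum rhs.
have sM : linear_subspace (closure (d @` form_domain F v D r)).
  apply: closure_linear_subspace; split.
    by exists (fun=> 0) => //; exact: (der0 derd).
  move=> c _ _ [a doma <-] [b domb <-]; exists (fun t => c * a t + b t).
    exact: dom_comb.
  exact: (der_linear derd).
split; first split=> //.
- exact: (reflection_bounded ipH sM PM).
- exact: (reflection_selfadj ipH PM).
- exact: (reflectionK ipH sM PM).
- by move=> a ca; exact: (commutator_compact ipH rhoH derd PM).
move=> a eps ca eps0; have [b domb ab] := dense a eps ca eps0.
exists b; split=> [||x]; first exact: domC.
  exact: (commutator_hilbert_schmidt ipH rhoH derd PM).
by rewrite rnormE lecR.
Qed.
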